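(* Let $\mathcal{A}$ be a complex unital $C^*$-algebra and let $a\in\mathcal{A}$ be a non-zero positive element. Then the following hold. (a) If $x,y,z\in\mathcal{A}_a$, $x^{\#_a}$ and $z^{\#_a}$ are $a$-adjoints of $x$ and $z$, and $\|y\|_a\le1$, then $$v_a\big(xyz^{\#_a}\big)\le\frac{\|y\|_a}{2}\big\|xx^{\#_a}+zz^{\#_a}\big\|_a .$$ (b) If $x,y,z\in\mathcal{A}$, $\|y\|\le1$ and $\phi$ is an Orlicz function, then $$\phi\big(v(xyz^* )\big)\le\frac{\|y\|}{2}\big\|\phi(xx^* )+\phi(zz^* )\big\| .$$
   Context: $\mathbf 1$ is the unit of $\mathcal{A}$. A functional $f\in\mathcal{A}^*$ is positive ($f\ge 0$) if $f(x^*x)\ge 0$ for all $x\in\mathcal{A}$. $\mathcal{S}(\mathcal{A})=\{g\in\mathcal{A}^*: g\ge0,\ g(\mathbf 1)=1\}$ is the set of states and $v(x)=\sup\{|g(x)|: g\in\mathcal{S}(\mathcal{A})\}$ is the (algebraic) numerical radius. For a non-zero positive $a\in\mathcal{A}$: $\mathcal{S}_a(\mathcal{A})=\{f\in\mathcal{A}^*: f\ge0,\ f(a)=1\}$; the $a$-numerical radius is $v_a(x)=\sup\{|f(ax)|: f\in\mathcal{S}_a(\mathcal{A})\}$; and $\|x\|_a=\sup\{\sqrt{f(x^*ax)}: f\in\mathcal{S}_a(\mathcal{A})\}$ (possibly $+\infty$ in general, but finite on $\mathcal{A}_a$). An $a$-adjoint of $x\in\mathcal{A}$ is an element $x^{\#_a}\in\mathcal{A}$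 with $ax^{\#_a}=x^*a$ (it need not exist or be unique); $\mathcal{A}_a$ is the set of all elements of $\mathcal{A}$ that have an $a$-adjoint. An Orlicz function is a map $\phi:[0,\infty)\to[0,\infty)$ that is continuous, convex, non-decreasing, with $\phi(0)=0$ and $\phi(u)\to\infty$ as $u\to\infty$; it is always assumed non-degenerate, i.e. $\phi(u)>0$ for $u>0$. For a positive element $y$, $\phi(y)$ is defined by continuous functional calculus. *)

(* Defs.v *)
From HB Require Import structures.
From mathcomp Require Import all_boot all_order all_algebra.
From mathcomp Require Import all_classical all_reals all_analysis.
From mathcomp Require Import complex.

Set Implicit Arguments.
Unset Strict Implicit.
Unset Printing Implicit Defensive.

Import Order.TTheory GRing.Theory Num.Theory.
Import numFieldNormedType.Exports.

Local Open Scope classical_set_scope.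
Local Open Scope ring_scope.
Local Open Scope complex_scope.

(* [cstar_norm] is a separate operation, because the hierarchy of the libraries
   has no join of the ring structures and the norm structures below numeric
   domains.  An [algType] is a non-trivial ring, with unit [1]. *)
HB.mixin Record isCStarAlgebra (R : realType) A of GRing.Algebra R[i] A := {
  star : A -> A ;
  starK : forall x : A, star (star x) = x ;
  starD : forall x y : A, star (x + y) = star x + star y ;
  starZ : forall (c : R[i]) (x : A), star (c *: x) = c^*%R *: star x ;
  starM : forall x y : A, star (x * y) = star y * star x ;
  cstar_norm : A -> R ;
  cstar_norm0_eq0 : forall x : A, cstar_norm x = 0 -> x = 0 ;
  cstar_normD : forall x y : A,
    cstar_norm (x + y) <= cstar_norm x + cstar_norm y ;
  cstar_normZ : forall (c : R[i]) (x : A),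
    cstar_norm (c *: x) = complex.Re `|c| * cstar_norm x ;
  cstar_normM : forall x y : A,
    cstar_norm (x * y) <= cstar_norm x * cstar_norm y ;
  cstar_norm_star : forall x : A, cstar_norm (star x * x) = cstar_norm x ^+ 2 ;
  cstar_complete : forall u : nat -> A,
    (forall e : R, 0 < e -> exists N, forall m n, (N <= m)%N -> (N <= n)%N ->
       cstar_norm (u m - u n) < e) ->
    exists l : A, cstar_norm (u n - l) @[n --> \oo] --> (0 : R)
}.

#[short(type="cstarAlgType")]
HB.structure Definition CStarAlgebra (R : realType) :=
  { A of GRing.Algebra R[i] A & isCStarAlgebra R A }.

(* The topology of the complex plane is that of [R[i]^o], as a normed space. *)
Definition continuous_on {R : realType} (S : set R[i]^o)
    (F : R[i]^o -> R[i]^o) := {within S, continuous F}.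

Section CStarAlgebraDefs.
Context {R : realType} {A : cstarAlgType R}.
Implicit Types (a x y : A) (f g : {linear A -> R[i]^o}).

Definition invertible x := exists2 y, x * y = 1 & y * x = 1.

Definition spectrum x : set R[i] := [set c | ~ invertible (x - c%:A)].

Definition positive x :=
  star x = x /\ forall c, spectrum x c -> 0 <= c.

Definition bounded_functional f :=
  exists M : R, forall x, complex.Re `|f x| <= M * cstar_norm x.

(* In [R[i]], [0 <= c] says that [c] is real and nonnegative. *)
Definition positive_functional f :=
  bounded_functional f /\ forall x, 0 <= f (star x * x).

Definition state : set {linear A -> R[i]^o} :=
  [set g | positive_functional g /\ g 1 = 1].

(* This set of reals is bounded, by [cstar_norm x], and nonempty. *)
Definition numerical_radius x : R :=
  sup [set complex.Re `|g x| | g in state].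

Definition state_at a : set {linear A -> R[i]^o} :=
  [set f | positive_functional f /\ f a = 1].

Definition numerical_radius_at a x : \bar R :=
  ereal_sup [set (complex.Re `|f (a * x)|)%:E | f in state_at a].

(* [f (star x * a * x)] is real and nonnegative when [a] is positive. *)
Definition seminorm_at a x : \bar R :=
  ereal_sup
    [set (Num.sqrt (complex.Re (f (star x * a * x))))%:E | f in state_at a].

Definition is_adjoint_at a x y := a * y = star x * a.

Definition adjointable_at a : set A := [set x | exists y, is_adjoint_at a x y].

(* [Phi] is a unital *-homomorphism from the algebra of continuous functions
   on the spectrum of [y] to [A] which sends the inclusion of the spectrum in
   the complex plane to [y].  A continuous function on the spectrum is
   represented by any function on [R[i]] that extends it. *)
Record is_functional_calculus y (Phi : (R[i] -> R[i]) -> A) : Prop := {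
  calculus_ext : forall F G : R[i] -> R[i],
    continuous_on (spectrum y) F -> continuous_on (spectrum y) G ->
    {in spectrum y, F =1 G} -> Phi F = Phi G ;
  calculus1 : Phi (fun=> 1) = 1 ;
  calculusD : forall F G : R[i] -> R[i],
    continuous_on (spectrum y) F -> continuous_on (spectrum y) G ->
    Phi (fun c => F c + G c) = Phi F + Phi G ;
  calculusM : forall F G : R[i] -> R[i],
    continuous_on (spectrum y) F -> continuous_on (spectrum y) G ->
    Phi (fun c => F c * G c) = Phi F * Phi G ;
  calculusZ : forall (k : R[i]) (F : R[i] -> R[i]),
    continuous_on (spectrum y) F ->
    Phi (fun c => k * F c) = k *: Phi F ;
  calculus_star : forall F : R[i] -> R[i],
    continuous_on (spectrum y) F ->
    Phi (fun c => (F c)^*%R) = star (Phi F) ;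
  calculus_id : Phi id = y
}.

(* For a normal [y] such a [Phi] exists, and its values on the functions that
   are continuous on the spectrum are uniquely determined. *)
Definition functional_calculus y : (R[i] -> R[i]) -> A :=
  xget (fun=> 0) [set Phi | is_functional_calculus y Phi].

(* The value at [y] of a function of a real variable, for a self-adjoint [y],
   whose spectrum is real. *)
Definition real_calculus (phi : R -> R) y : A :=
  functional_calculus y (fun c => (phi (complex.Re c))%:C).

End CStarAlgebraDefs.

(* Only the values of [phi] on [0, +oo[ are constrained. *)
Record orlicz_function {R : realType} (phi : R -> R) : Prop := {
  orlicz_ge0 : forall u : R, 0 <= u -> 0 <= phi u ;
  orlicz_continuous : {within `[0, +oo[, continuous phi} ;
  orlicz_convex : convex_function (`[0, +oo[ : set R) phi ;
  orlicz_nondecreasing : {in `[0, +oo[ &, {homo phi : u w / u <= w}} ;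
  orlicz0 : phi 0 = 0 ;
  orlicz_cvgy : phi u @[u --> +oo] --> +oo ;
  orlicz_gt0 : forall u : R, 0 < u -> 0 < phi u
}.

(* Main.v *)
From HB Require Import structures.
Require Import Defs.
From mathcomp Require Import all_boot all_order all_algebra.
From mathcomp Require Import all_classical all_reals all_analysis.
From mathcomp Require Import complex ring lra.

Set Implicit Arguments.
Unset Strict Implicit.
Unset Printing Implicit Defensive.

Import Order.TTheory GRing.Theory Num.Theory.
Import numFieldNormedType.Exports.

Local Open Scope classical_set_scope.
Local Open Scope ring_scope.
Local Open Scope complex_scope.

(* For (a), writing [a = b ^+ 2] turns [f (star u * a * v)] into a semi-inner
   product of [u] and [v], and [f (a * x * y * zs)] is its value at [xs] and
   [y * zs]; the Cauchy-Schwarz and arithmetic-geometric inequalities conclude.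
   For (b), the same argument bounds [|f (x * y * star z)|] by
   [|y| / 2 * (f (x * star x) + f (z * star z))], and the convexity of [phi] moves
   [phi] inside, the last step being Jensen's inequality
   [phi (f h) <= f (phi h)], which follows from a support line of [phi].

   Square roots and the functional calculus are obtained without Gelfand theory or
   complex analysis.  The root of [1 - k], for [|k| <= 1], is the limit of
   [y := (k + y ^+ 2) / 2].  If [x] and [y] are commuting self-adjoint elements with
   [x ^+ 2 + y ^+ 2 = r], then [x + i y] has norm [sqrt |r|], so [|x| ^+ 2 <= |r|];
   this replaces order arguments, and shows that a self-adjoint element with
   nonnegative spectrum is a square.  With the spectral mapping theorem, it bounds
   [|p h|] by the supremum of [|p|] on the spectrum of [h], and Bernstein
   polynomials extend the calculus to continuous functions. *)

(** * Norm and convergence *)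

Section NormBasics.
Context {R : realType} {A : cstarAlgType R}.
Implicit Types (x y z u v : A) (c : R[i]) (r : R).

Local Notation N := (@cstar_norm R A).

Lemma star0 : star (0 : A) = 0.
Proof. by apply: (addrI (star (0 : A))); rewrite -starD !addr0. Qed.

Lemma starN x : star (- x) = - star x.
Proof. by apply: (addrI (star x)); rewrite -starD !subrr star0. Qed.

Lemma starB x y : star (x - y) = star x - star y.
Proof. by rewrite starD starN. Qed.

Lemma star1 : star (1 : A) = 1.
Proof. by rewrite -[LHS]mulr1 -[X in _ * X]starK -starM mulr1 starK. Qed.

Lemma starZr r x : star (r%:C *: x) = r%:C *: star x.
Proof. by rewrite starZ; congr (_ *: _); apply: conjc_real. Qed.

Lemma starX x n : star (x ^+ n) = star x ^+ n.
Proof. by elim: n => [|n IH]; rewrite ?expr0 ?star1 // exprS starM IH -exprSr. Qed.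

Lemma cnormE c : `|c| = (complex.Re `|c|)%:C.
Proof. by rewrite RRe_real // normr_real. Qed.

Lemma cnorm_ge0 c : 0 <= complex.Re `|c|.
Proof. by rewrite -ler0c -cnormE. Qed.

Lemma cnormr r : complex.Re `|r%:C| = `|r|.
Proof. by rewrite normc_def /= expr0n addr0 sqrtr_sqr. Qed.

Lemma cnormM c d : complex.Re `|c * d| = complex.Re `|c| * complex.Re `|d|.
Proof. by apply: complexI; rewrite rmorphM /= -!cnormE normrM. Qed.

Lemma cnormD c d : complex.Re `|c + d| <= complex.Re `|c| + complex.Re `|d|.
Proof. by rewrite -lecR rmorphD /= -!cnormE ler_normD. Qed.

Lemma norm_scaler r x : N (r%:C *: x) = `|r| * N x.
Proof. by rewrite cstar_normZ cnormr. Qed.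

Lemma norm0 : N 0 = 0.
Proof. by rewrite -[0 in LHS](scale0r (0 : A)) norm_scaler normr0 mul0r. Qed.

Lemma normN x : N (- x) = N x.
Proof. by rewrite -scaleN1r cstar_normZ normrN1 mul1r. Qed.

Lemma norm_ge0 x : 0 <= N x.
Proof.
have := cstar_normD x (- x); rewrite subrr norm0 normN; lra.
Qed.

Lemma normB x y : N (x - y) <= N x + N y.
Proof. by rewrite -(normN y) cstar_normD. Qed.

Lemma norm_eq0 x : (N x == 0) = (x == 0).
Proof.
by apply/eqP/eqP => [/cstar_norm0_eq0 //|->]; exact: norm0.
Qed.

Lemma norm_gt0 x : x != 0 -> 0 < N x.
Proof. by move=> x0; rewrite lt_neqAle norm_ge0 andbT eq_sym norm_eq0. Qed.

(** The C*-identity gives [N x ^+ 2 = N (star x * x) <= N (star x) * N x], from which one factor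
    [N x] cancels. *)
Lemma le_norm_star x : N x <= N (star x).
Proof.
have [->|x0] := eqVneq x 0; first by rewrite star0.
rewrite -(ler_pM2r (norm_gt0 x0)) -expr2 -cstar_norm_star; exact: cstar_normM.
Qed.

Lemma norm_star x : N (star x) = N x.
Proof. by apply/le_anti; rewrite le_norm_star -{2}(starK x) le_norm_star. Qed.

Lemma norm1 : N 1 = 1.
Proof.
have n0 : N 1 != 0 by rewrite norm_eq0 oner_neq0.
by apply: (mulfI n0); rewrite mulr1 -expr2 -cstar_norm_star star1 mulr1.
Qed.

Lemma norm_realA r : N r%:C%:A = `|r|.
Proof. by rewrite norm_scaler norm1 mulr1. Qed.

Lemma norm_sa_sqr x : star x = x -> N (x ^+ 2) = N x ^+ 2.
Proof. by move=> xs; rewrite -cstar_norm_star xs expr2. Qed.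

Lemma norm_le_eq0 x : (forall e : R, 0 < e -> N x <= e) -> x = 0.
Proof.
move=> h; apply/eqP; rewrite -norm_eq0 eq_le norm_ge0 andbT.
by apply/ler_addgt0Pr => e e0; rewrite add0r h.
Qed.

Definition converges_to (u : nat -> A) (l : A) :=
  forall e : R, 0 < e -> exists m, forall n, (m <= n)%N -> N (u n - l) <= e.

Lemma cauchy_converges (u : nat -> A) :
  (forall e : R, 0 < e -> exists m, forall n, (m <= n)%N -> N (u n - u m) <= e) ->
  exists l, converges_to u l.
Proof.
move=> cu.
have [e e0|l ul] := @cstar_complete R A u.
  have e4 : 0 < e / 4 by lra.
  have [m hm] := cu _ e4; exists m => p q mp mq.
  have -> : u p - u q = (u p - u m) - (u q - u m) by rewrite opprB addrA subrK.
  have := normB (u p - u m) (u q - u m); have := hm _ mp; have := hm _ mq; lra.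
exists l => e e0.
move/cvgrPdist_le : ul => /(_ e e0) [m _ hm].
exists m => n mn; have := hm n mn.
by rewrite sub0r normrN ger0_norm // norm_ge0.
Qed.

(** Method of majorants: [eta] is nondecreasing and bounded, hence Cauchy, and its increments
    dominate those of [u]. Both iterations below, for inverses and for square roots, converge in
    this way. *)
Lemma telescope_converges (u : nat -> A) (eta : nat -> R) (M : R) :
  (forall n, N (u n.+1 - u n) <= eta n.+1 - eta n) -> (forall n, eta n <= M) ->
  exists l, converges_to u l.
Proof.
move=> ue eM.
have emono : nondecreasing_seq eta.
  by apply/nondecreasing_seqP => n; rewrite -subr_ge0 (le_trans (norm_ge0 _) (ue n)).
have inc m n : N (u (m + n)%N - u m) <= eta (m + n)%N - eta m.
  elim: n => [|n IH]; first by rewrite addn0 !subrr norm0.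
  rewrite addnS -(subrKA (u (m + n)%N)); apply: le_trans (cstar_normD _ _) _.
  by have := ue (m + n)%N; lra.
apply: cauchy_converges => e e0.
have hb : has_ubound (range eta) by exists M => _ [n _ <-].
have hs : has_sup (range eta) by split=> //; exists (eta 0%N); exists 0%N.
(* From an index where [eta] is within [e] of its supremum, the total remaining increment is at most
   [e]. *)
have [_ [m _ <-] hm] := sup_adherent e0 hs.
exists m => n mn; rewrite -(subnKC mn); apply: le_trans (inc _ _) _.
have : eta (m + (n - m))%N <= sup (range eta) by apply: ub_le_sup => //; exists (m + (n-m))%N.
lra.
Qed.

(** Two consecutive terms near the limit are what is needed to pass to the limit in a recursion for
    [u n.+1] in terms of [u n]. *)
Lemma converges2 (u : nat -> A) l (e : R) : converges_to u l -> 0 < e ->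
  exists n, N (u n - l) <= e /\ N (u n.+1 - l) <= e.
Proof.
by move=> ul e0; have [m hm] := ul e e0; exists m; split; apply: hm.
Qed.

Lemma converges_comm (u : nat -> A) l z : converges_to u l ->
  (forall n, z * u n = u n * z) -> z * l = l * z.
Proof.
move=> ul zu; apply/subr0_eq/norm_le_eq0 => e e0.
have nz : 0 < N z + 1 by rewrite ltr_wpDl // norm_ge0.
have e1 : 0 < e / (2 * (N z + 1)) by rewrite divr_gt0 // mulr_gt0.
have [n [hn _]] := converges2 ul e1.
have -> : z * l - l * z = (u n - l) * z - z * (u n - l).
  by rewrite mulrBl mulrBr zu opprB [RHS]addrC subrKA.
apply: le_trans (normB _ _) _.
apply: le_trans (lerD (cstar_normM _ _) (cstar_normM _ _)) _.
move: hn; rewrite ler_pdivlMr ?mulr_gt0 //; apply: le_trans.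
by move: (N z) (N _) (norm_ge0 (u n - l)) => p q q0; lra.
Qed.

Lemma converges_star (u : nat -> A) l : converges_to u l ->
  (forall n, star (u n) = u n) -> star l = l.
Proof.
move=> ul us; apply/subr0_eq/norm_le_eq0 => e e0.
have e1 : 0 < e / 2 by lra.
have [n [hn _]] := converges2 ul e1.
have -> : star l - l = (u n - l) - star (u n - l).
  by rewrite starB us opprB [RHS]addrC subrKA.
have := normB (u n - l) (star (u n - l)); rewrite norm_star; lra.
Qed.

Lemma converges_norm_le (u : nat -> A) l v (M : R) : converges_to u l ->
  (forall n, N (u n - v) <= M) -> N (l - v) <= M.
Proof.
move=> ul uM; apply/ler_addgt0Pr => e e0.
have [n [hn _]] := converges2 ul e0.
have -> : l - v = (u n - v) - (u n - l) by rewrite opprB [RHS]addrC subrKA.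
apply: le_trans (normB _ _) _; exact: lerD.
Qed.

End NormBasics.

(** * Neumann series and square roots *)

Section Sqrt.
Context {R : realType} {A : cstarAlgType R}.
Implicit Types (x y z u v : A) (c : R[i]) (r : R).

Local Notation N := (@cstar_norm R A).

Lemma neumann k : N k < 1 -> invertible (1 - k).
Proof.
move=> k1.
(* The partial sums of the geometric series of [k], and those of [N k] as majorant, the latter
   bounded by [(1 - N k)^-1]. *)
pose u n : A := iter n (fun e => 1 + k * e) 0.
pose eta n : R := iter n (fun e => 1 + N k * e) 0.
have uS n : u n.+1 = 1 + k * u n by [].
have etaS n : eta n.+1 = 1 + N k * eta n by [].
have ku n : GRing.comm k (u n).
  elim: n => [|n IH]; first exact: commr0.
  by rewrite uS; apply: commrD (commr1 _) (commrM (commr_refl _) IH).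
have ueta n : N (u n.+1 - u n) <= eta n.+1 - eta n.
  elim: n => [|n IH]; first by rewrite !uS !etaS /u /eta /= !mulr0 !addr0 !subr0 norm1.
  have -> : u n.+2 - u n.+1 = k * (u n.+1 - u n).
    by rewrite (uS n.+1) [X in _ - X]uS opprD addrACA subrr add0r mulrBr.
  have -> : eta n.+2 - eta n.+1 = N k * (eta n.+1 - eta n).
    by rewrite (etaS n.+1) [X in _ - X]etaS; ring.
  by apply: le_trans (cstar_normM _ _) _; rewrite ler_wpM2l ?norm_ge0.
have etaM n : eta n <= (1 - N k)^-1.
  have k1' : 0 < 1 - N k by lra.
  elim: n => [|n IH]; first by rewrite invr_ge0; lra.
  rewrite etaS; have := ler_wpM2l (norm_ge0 k) IH.
  have : (1 - N k) * (1 - N k)^-1 = 1 by rewrite divff // gt_eqF.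
  lra.
have [e ue] := telescope_converges ueta etaM.
have ke : k * e = e * k by apply: (converges_comm ue) => n; apply: ku.
have ee : e = 1 + k * e.
  apply/subr0_eq/norm_le_eq0 => d d0.
  have d2 : 0 < d / 2 by lra.
  have [n [h1 h2]] := converges2 ue d2.
  have -> : e - (1 + k * e) = k * (u n - e) - (u n.+1 - e).
    by rewrite uS mulrBr opprB [RHS]addrC !opprD !addrA subrK.
  apply: le_trans (normB _ _) _; apply: le_trans (lerD (cstar_normM _ _) h2) _.
  have := norm_ge0 k; have := norm_ge0 (u n - e).
  by move: (N _) (N k) h1 k1 => p q; nra.
exists e; first by rewrite mulrBl mul1r {1}ee addrK.
by rewrite mulrBr mulr1 -ke {1}ee addrK.
Qed.

(** A fixed point [y] of the iteration satisfies [y + y = k + y ^+ 2], that is,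
    [(1 - y) ^+ 2 = 1 - k]. The commutation clause passes to the limit from the iterates, which are
    polynomials in [k]. *)
Lemma sqrt_one_sub k : star k = k -> N k <= 1 ->
  exists b, [/\ star b = b, b ^+ 2 = 1 - k &
    forall z, GRing.comm z k -> GRing.comm z b].
Proof.
move=> ks k1.
pose u n : A := iter n (fun y => (2^-1)%:C *: (k + y ^+ 2)) 0.
(* The same iteration with [k] replaced by its bound 1. It stays in [0, 1] and dominates the norms
   of the terms of [u]; factoring a difference of squares, it dominates their increments too. *)
pose eta n : R := iter n (fun e => 2^-1 * (1 + e ^+ 2)) 0.
have uS n : u n.+1 = (2^-1)%:C *: (k + u n ^+ 2) by [].
have etaS n : eta n.+1 = 2^-1 * (1 + eta n ^+ 2) by [].
have uc n z : GRing.comm z k -> GRing.comm z (u n).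
  move=> zk; elim: n => [|n IH]; first exact: commr0.
  have := commrD zk (commrX 2 IH); rewrite /GRing.comm uS => h.
  by rewrite -scalerAr -scalerAl h.
have us n : star (u n) = u n.
  elim: n => [|n IH]; first exact: star0.
  by rewrite uS starZr starD starX IH ks.
have eta01 n : 0 <= eta n <= 1.
  by elim: n => [|n /andP[h1 h2]]; rewrite ?etaS; apply/andP; split=> //; nra.
have ueta1 n : N (u n) <= eta n.
  elim: n => [|n IH]; first by rewrite norm0.
  rewrite uS norm_scaler ger0_norm ?invr_ge0 // etaS ler_wpM2l ?invr_ge0 //.
  apply: le_trans (cstar_normD _ _) _; rewrite lerD // norm_sa_sqr //.
  by rewrite ler_pXn2r ?nnegrE ?norm_ge0 //; case/andP: (eta01 n).
have uu n : GRing.comm (u n) (u n.+1).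
  by apply: (uc); apply/commr_sym/uc; apply: commr_refl.
have ueta n : N (u n.+1 - u n) <= eta n.+1 - eta n.
  elim: n => [|n IH].
    rewrite uS etaS /u /eta /= !expr0n /= !addr0 !subr0 norm_scaler.
    by rewrite ger0_norm ?invr_ge0 // ler_wpM2l ?invr_ge0.
  have -> : u n.+2 - u n.+1 = (2^-1)%:C *: ((u n.+1 - u n) * (u n.+1 + u n)).
    rewrite (uS n.+1) [X in _ - X]uS -scalerBr opprD addrACA subrr add0r.
    by rewrite mulrDr !mulrBl -!expr2 uu addrA subrK.
  have -> : eta n.+2 - eta n.+1 = 2^-1 * ((eta n.+1 - eta n) * (eta n.+1 + eta n)).
    by rewrite (etaS n.+1) [X in _ - X]etaS; ring.
  rewrite norm_scaler ger0_norm ?invr_ge0 // ler_wpM2l ?invr_ge0 //.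
  apply: le_trans (cstar_normM _ _) _; apply: ler_pM => //; rewrite ?norm_ge0 //.
  by apply: le_trans (cstar_normD _ _) _; apply: lerD.
have etaM n : eta n <= 1 by case/andP: (eta01 n).
have [y uy] := telescope_converges ueta etaM.
have ys := converges_star uy us.
have yc z : GRing.comm z k -> GRing.comm z y.
  by move=> zk; apply: (converges_comm uy) => n; apply: uc.
have y1 : N y <= 1.
  rewrite -[y]subr0; apply: (converges_norm_le uy) => n.
  by rewrite subr0 (le_trans (ueta1 n)).
have yy : y + y = k + y ^+ 2.
  apply/subr0_eq/norm_le_eq0 => d d0.
  have d2 : 0 < d / 4 by lra.
  have [n [h1 h2]] := converges2 uy d2.
  have -> : y + y - (k + y ^+ 2) =
     (u n ^+ 2 - y ^+ 2) - ((u n.+1 - y) + (u n.+1 - y)).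
    have -> : u n ^+ 2 = (u n.+1 + u n.+1) - k.
      rewrite -mulr2n uS -scaler_nat scalerA -[2%:R](rmorph_nat (real_complex R)).
      by rewrite -rmorphM /= divff // scale1r addrC addKr.
    rewrite [in RHS]opprD !opprB [RHS]addrC [y - _ + _]addrACA -opprD.
    by rewrite -[_ - k - _]addrA subrKA opprD.
  have -> : u n ^+ 2 - y ^+ 2 = (u n - y) * (u n + y).
    have unk : GRing.comm y (u n) by apply: uc; apply/commr_sym/yc/commr_refl.
    by rewrite mulrDr !mulrBl -!expr2 unk addrA subrK.
  apply: le_trans (normB _ _) _.
  apply: le_trans (lerD (cstar_normM _ _) (cstar_normD _ _)) _.
  have := cstar_normD (u n) y; have := ueta1 n; have := etaM n.
  have := norm_ge0 (u n - y).
  move: h1 h2 y1; move: (N _) (N _) (N _) (N _) (N _) (eta n) => p q s t w e.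
  nra.
exists (1 - y); split; first by rewrite starB star1 ys.
  by rewrite expr2 mulrBl mul1r mulrBr mulr1 -addrA -opprD addrA yy addrK.
by move=> z zk; apply: commrB (commr1 _) (yc _ zk).
Qed.

End Sqrt.

(** * Invertible elements, the spectrum and the norm of self-adjoint elements *)

Section Spectrum.
Context {R : realType} {A : cstarAlgType R}.
Implicit Types (x y z u v : A) (c : R[i]) (r : R).

Local Notation N := (@cstar_norm R A).

Lemma invertible_left_right x y z : x * y = 1 -> z * x = 1 -> invertible x.
Proof.
move=> xy zx; exists y => //.
suff -> : y = z by [].
by rewrite -[y]mul1r -zx -mulrA xy mulr1.
Qed.

Lemma invertibleM x y : invertible x -> invertible y -> invertible (x * y).
Proof.
move=> [x' xx' x'x] [y' yy' y'y]; exists (y' * x').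
  by rewrite mulrA -(mulrA x) yy' mulr1.
by rewrite mulrA -(mulrA y') x'x mulr1.
Qed.

Lemma invertibleZ (k : R[i]) x : k != 0 -> invertible x -> invertible (k *: x).
Proof.
move=> k0 [y xy yx]; exists (k^-1 *: y).
  by rewrite -scalerAl -scalerAr scalerA divff // scale1r.
by rewrite -scalerAl -scalerAr scalerA mulVf // scale1r.
Qed.

Lemma invertible_commMl x y : GRing.comm x y -> invertible (x * y) -> invertible x.
Proof.
move=> xy [e h1 h2]; apply: (@invertible_left_right x (y * e) (e * y)).
  by rewrite mulrA.
by rewrite -mulrA -xy.
Qed.

Lemma comm_inverse x y z : x * y = 1 -> y * x = 1 -> GRing.comm z x ->
  GRing.comm z y.
Proof.
move=> xy yx zx; rewrite /GRing.comm -[LHS]mul1r -yx -mulrA (mulrA x) -zx.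
by rewrite -(mulrA z) xy mulr1.
Qed.

Lemma comm_scaler (k : R[i]) x y : GRing.comm x y -> GRing.comm x (k *: y).
Proof. by rewrite /GRing.comm -scalerAr -scalerAl => ->. Qed.

Lemma comm_scalar (k : R[i]) x : GRing.comm x k%:A.
Proof. exact/comm_scaler/commr1. Qed.

Lemma spectrumZ c (k : R[i]) x : k != 0 -> spectrum (k *: x) c ->
  spectrum x (k^-1 * c).
Proof.
move=> k0 hc hi; apply: hc.
have -> : k *: x - c%:A = k *: (x - (k^-1 * c)%:A).
  by rewrite scalerBr scalerA mulrA divff // mul1r.
exact: invertibleZ.
Qed.

(** For [|c| > N x], the element [x - c] equals [- c *: (1 - c^-1 *: x)], which the Neumann series
    inverts. *)
Lemma spectrum_norm_le x c : spectrum x c -> complex.Re `|c| <= N x.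
Proof.
move=> hc; rewrite leNgt; apply/negP => lt; apply: hc.
have c0 : c != 0.
  by apply: contraTneq lt => ->; rewrite normr0 -leNgt norm_ge0.
have -> : x - c%:A = - c *: (1 - c^-1 *: x).
  by rewrite scaleNr scalerBr scalerA divff // scale1r opprB.
apply: invertibleZ; rewrite ?oppr_eq0 //; apply: neumann.
rewrite cstar_normZ.
have h : complex.Re `|c^-1| * complex.Re `|c| = 1.
  by rewrite -cnormM mulVf // normr1.
have := norm_ge0 x; have := cnorm_ge0 c^-1; nra.
Qed.

(** For [w = x + i y], commutation turns [star w * w] into [x ^+ 2 + y ^+ 2 = r], so
    [N w ^+ 2 = |r|]; and [x] is the mean of [w] and [star w], which have the same norm. *)
Lemma norm_sumsq x y r : star x = x -> star y = y -> GRing.comm x y ->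
  x ^+ 2 + y ^+ 2 = r%:C%:A -> N x ^+ 2 <= `|r|.
Proof.
move=> xs ys xy h.
pose w := x + 'i *: y.
have sw : star w = x - 'i *: y.
  by rewrite starD starZ xs ys -scaleNr; congr (_ + _ *: _); apply: conjCi.
have ww : star w * w = r%:C%:A.
  rewrite sw mulrBl !mulrDr -!scalerAr -!scalerAl scalerA -!expr2.
  by rewrite sqr_i scaleN1r xy -h opprD opprK addrA addrK.
have wn : N w ^+ 2 = `|r| by rewrite -cstar_norm_star ww norm_realA.
rewrite -wn ler_pXn2r ?nnegrE ?norm_ge0 //.
have : N (x + x) <= N w + N (star w).
  have -> : x + x = w + star w by rewrite sw addrACA subrr addr0.
  exact: cstar_normD.
rewrite norm_star -mulr2n -scaler_nat -[2%:R](rmorph_nat (real_complex R)).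
rewrite norm_scaler /= ger0_norm //; lra.
Qed.

(** Suppose [rho = N (1 - x) > 1] and let [n = (1 - x) / rho], of norm 1. As [1 - rho < 0] is
    outside the spectrum of [x], [1 - n] has an inverse [e], and this leaves room to subtract
    [1 / N e] from [1 - n] and still have a square. Then [norm_sumsq] bounds [N n] by
    [1 - 1 / N e < 1], a contradiction. *)
Lemma norm_one_sub_le1 x : star x = x -> N x <= 1 ->
  (forall c, spectrum x c -> 0 <= c) -> N (1 - x) <= 1.
Proof.
move=> xs x1 xpos; rewrite leNgt; apply/negP; set rho := N (1 - x) => rho1.
have [c [cs c2 cc]] := sqrt_one_sub xs x1.
have rho0 : 0 < rho by lra.
pose n : A := (rho^-1)%:C *: (1 - x).
have ns : star n = n by rewrite starZr starB star1 xs.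
have nn : N n = 1 by rewrite norm_scaler gtr0_norm ?invr_gt0 // mulVf // gt_eqF.
have n1 : N n <= 1 by rewrite nn.
have [d [ds d2 dc]] := sqrt_one_sub ns n1.
pose c' := (Num.sqrt rho^-1)%:C *: c.
have c's : star c' = c' by rewrite starZr cs.
have c'2 : c' ^+ 2 = n.
  rewrite expr2 -scalerAl -scalerAr scalerA -rmorphM /= -!expr2.
  by rewrite sqr_sqrtr ?invr_ge0 ?ltW // c2.
have xd : GRing.comm x d.
  apply: dc; apply: comm_scaler; apply: commrB (commr1 _) (commr_refl _).
have c'd : GRing.comm c' d.
  by apply: commr_sym; apply: comm_scaler; apply: cc; apply: commr_sym.
have [e e1 e2] : invertible (1 - n).
  have nrho : 1 - n = (rho^-1)%:C *: (x - (1 - rho)%:C%:A).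
    have -> : x - (1 - rho)%:C%:A = rho%:C%:A - (1 - x).
      by rewrite rmorphB rmorph1 scalerBl scale1r !opprB addrCA.
    by rewrite scalerBr scalerA -rmorphM /= mulVf ?gt_eqF // scale1r.
  rewrite nrho; apply: invertibleZ.
    by rewrite fmorph_eq0 invr_eq0 gt_eqF.
  apply: contrapT => h; have := xpos _ h; rewrite ler0c; lra.
have es : star e = e.
  rewrite -[star e]mulr1 -e1 mulrA.
  have -> : star e * (1 - n) = 1.
    by rewrite -{1}ns -{1}star1 -starB -starM e1 star1.
  by rewrite mul1r.
set K := N e.
have d21 : N d ^+ 2 <= 1.
  rewrite -[leRHS]normr1; apply: (norm_sumsq ds c's (commr_sym c'd)).
  by rewrite d2 c'2 subrK scale1r.
(* From [e * (1 - n) = 1] and [N (1 - n) = N d ^+ 2 <= 1]; it ensures that [1 - K^-1] is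
   nonnegative. *)
have K1 : 1 <= K.
  have := cstar_normM e (1 - n); rewrite e2 norm1 -d2 norm_sa_sqr //.
  have := norm_ge0 e; rewrite -/K; nra.
have K0 : 0 < K by lra.
have ks : star ((K^-1)%:C *: e) = (K^-1)%:C *: e by rewrite starZr es.
have kn : N ((K^-1)%:C *: e) <= 1.
  by rewrite norm_scaler gtr0_norm ?invr_gt0 // mulVf // gt_eqF.
have [g [gs g2 gc]] := sqrt_one_sub ks kn.
have ec z : GRing.comm z n -> GRing.comm z e.
  by move=> zn; apply: (comm_inverse e1 e2); apply: commrB (commr1 _) zn.
have c'e : GRing.comm c' e by apply: ec; rewrite -c'2; apply: commrX (commr_refl _).
have dn : GRing.comm d n.
  have -> : n = 1 - d ^+ 2 by rewrite d2 opprB addrC subrK.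
  by apply: commrB (commr1 _) (commrX _ (commr_refl _)).
have gd : GRing.comm g d.
  by apply: commr_sym; apply: gc; apply: comm_scaler; apply: ec.
(* Since [g ^+ 2 = 1 - K^-1 e] and [d ^+ 2 = 1 - n] is the inverse of [e], the product of these
   squares is [1 - n - K^-1], and [c' ^+ 2 = n] cancels. *)
have : c' ^+ 2 + (g * d) ^+ 2 = (1 - K^-1)%:C%:A.
  rewrite exprMn_comm // g2 d2 c'2 mulrBl mul1r -scalerAl e2.
  by rewrite addrA [n + _]addrC subrK rmorphB rmorph1 scalerBl scale1r.
move=> /norm_sumsq -/(_ c's) h.
have : N c' ^+ 2 <= `|1 - K^-1|.
  apply: h; first by rewrite starM gs ds -gd.
  apply: commrM c'd; apply: gc; exact: comm_scaler.
rewrite -norm_sa_sqr // c'2 nn ger0_norm; last by rewrite subr_ge0 invf_le1.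
by have := invr_gt0 K; rewrite K0; lra.
Qed.

End Spectrum.

(** * Square roots, and reality or nonnegativity of spectra *)

Section Positivity.
Context {R : realType} {A : cstarAlgType R}.
Implicit Types (x y z u v b h : A) (c : R[i]) (r : R).

Local Notation N := (@cstar_norm R A).

Lemma realC_neq0 r : (r%:C != 0) = (r != 0).
Proof. by rewrite fmorph_eq0. Qed.

Lemma realC_gt0 r : (0 < r%:C) = (0 < r).
Proof. exact: (ltcR 0). Qed.

Lemma sqrt_of_norm_sub x r : star x = x -> 0 < r -> N (r%:C%:A - x) <= r ->
  exists b, [/\ star b = b, b ^+ 2 = x &
    forall z, GRing.comm z x -> GRing.comm z b].
Proof.
move=> xs r0 rx.
have rV0 : 0 < r^-1 by rewrite invr_gt0.
pose k : A := 1 - (r^-1)%:C *: x.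
have ks : star k = k by rewrite starB star1 starZr xs.
have k1 : N k <= 1.
  have -> : k = (r^-1)%:C *: (r%:C%:A - x).
    by rewrite scalerBr scalerA -rmorphM /= mulVf ?gt_eqF // scale1r.
  by rewrite norm_scaler gtr0_norm // mulrC ler_pdivrMr // mul1r.
have [b [bs b2 bc]] := sqrt_one_sub ks k1.
exists ((Num.sqrt r)%:C *: b); split.
- by rewrite starZr bs.
- rewrite exprZn b2 opprB addrC subrK scalerA -rmorphXn -rmorphM /=.
  by rewrite sqr_sqrtr ?ltW // divff ?gt_eqF // scale1r.
- move=> z zx; apply: comm_scaler; apply: bc; apply: commrB (commr1 _) _.
  exact: comm_scaler.
Qed.

Lemma sqrt_of_spectrum_ge0 x : star x = x ->
  (forall c, spectrum x c -> 0 <= c) ->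
  exists b, [/\ star b = b, b ^+ 2 = x &
    forall z, GRing.comm z x -> GRing.comm z b].
Proof.
move=> xs xpos; have [->|x0] := eqVneq x 0.
  by exists 0; split=> [||z _]; rewrite ?star0 ?expr0n //; apply: commr0.
have nx := norm_gt0 x0; have nxV : 0 < (N x)^-1 by rewrite invr_gt0.
apply: (sqrt_of_norm_sub xs nx).
have -> : (N x)%:C%:A - x = (N x)%:C *: (1 - ((N x)^-1)%:C *: x).
  by rewrite scalerBr scalerA -rmorphM /= divff ?gt_eqF // scale1r.
rewrite norm_scaler gtr0_norm // ger_pMr //; apply: norm_one_sub_le1.
- by rewrite starZr xs.
- by rewrite norm_scaler gtr0_norm // mulVf ?gt_eqF.
- move=> c /spectrumZ; rewrite realC_neq0 gt_eqF // => /(_ isT)/xpos.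
  by rewrite pmulr_rge0 // invr_gt0 realC_gt0.
Qed.

(** [r - x ^+ 2] is itself a square [y ^+ 2] with [y] commuting with [x]; as [y ^+ 2 + x ^+ 2 = r],
    [norm_sumsq] bounds [N y ^+ 2]. *)
Lemma norm_sub_sqr x r : star x = x -> N x ^+ 2 <= r -> N (r%:C%:A - x ^+ 2) <= r.
Proof.
move=> xs; have [->|x0] := eqVneq x 0.
  move=> r0; rewrite expr0n /= subr0 norm_realA ger0_norm //.
  by apply: le_trans r0; rewrite sqr_ge0.
move=> xr; have r0 : 0 < r by apply: lt_le_trans xr; rewrite exprn_gt0 ?norm_gt0.
pose k : A := (r^-1)%:C *: x ^+ 2.
have ks : star k = k by rewrite starZr starX xs.
have k1 : N k <= 1.
  rewrite norm_scaler gtr0_norm ?invr_gt0 // mulrC ler_pdivrMr // mul1r.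
  by rewrite norm_sa_sqr.
have [b [bs b2 bc]] := sqrt_one_sub ks k1.
pose y := (Num.sqrt r)%:C *: b.
have ys : star y = y by rewrite starZr bs.
have y2 : y ^+ 2 = r%:C%:A - x ^+ 2.
  rewrite exprZn b2 scalerBr scalerA -rmorphXn -rmorphM /=.
  by rewrite sqr_sqrtr ?ltW // divff ?gt_eqF // scale1r.
rewrite -y2 norm_sa_sqr // -[leRHS]gtr0_norm //.
apply: (norm_sumsq ys xs); last by rewrite y2 subrK.
apply: commr_sym; apply: comm_scaler; apply: bc; apply: comm_scaler.
exact: commrX (commr_refl _).
Qed.

(** This stands in for the additivity of the cone of positive elements: the norm condition of
    [sqrt_of_norm_sub], unlike a condition on spectra, is stable under sums. *)
Lemma sum_sqr x y : star x = x -> star y = y ->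
  exists b, star b = b /\ b ^+ 2 = x ^+ 2 + y ^+ 2.
Proof.
move=> xs ys.
(* The two added units keep the constant positive when [x] and [y] both vanish. *)
have M0 : 0 < (N x ^+ 2 + 1) + (N y ^+ 2 + 1).
  by have := sqr_ge0 (N x); have := sqr_ge0 (N y); lra.
have [||b [bs b2 _]] := @sqrt_of_norm_sub (x ^+ 2 + y ^+ 2) _ _ M0.
- by rewrite starD !starX xs ys.
- rewrite rmorphD scalerDl opprD addrACA; apply: le_trans (cstar_normD _ _) _.
  by rewrite lerD ?norm_sub_sqr // lerDl.
- by exists b.
Qed.

Lemma invertibleN x : invertible (- x) -> invertible x.
Proof.
move=> hx; rewrite -[x]opprK -scaleN1r; apply: invertibleZ hx.
by rewrite oppr_eq0 oner_eq0.
Qed.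

(** With [s = N x ^+ 2], the element is [- ((s - x ^+ 2) - (s + r))], and [s + r] exceeds the norm
    of [s - x ^+ 2]. *)
Lemma invertible_sqrD x r : star x = x -> 0 < r -> invertible (x ^+ 2 + r%:C%:A).
Proof.
move=> xs r0; set s := N x ^+ 2.
have le := norm_sub_sqr xs (lexx s).
have := @spectrum_norm_le R A (s%:C%:A - x ^+ 2) (s + r)%:C.
rewrite cnormr => h; apply: invertibleN; apply: contrapT => hi.
have /h : spectrum (s%:C%:A - x ^+ 2) (s + r)%:C.
  by rewrite /spectrum /= rmorphD scalerDl opprD addrACA subrr add0r -opprD.
have s0 : 0 <= s by apply: sqr_ge0.
rewrite ger0_norm; lra.
Qed.

Lemma mul_conj_scalar x (k : R[i]) :
  (x - k%:A) * (x + k%:A) = x ^+ 2 - (k ^+ 2)%:A.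
Proof.
rewrite mulrDr !mulrBl -expr2 -(comm_scalar k x) addrA subrK.
by rewrite -scalerAl mul1r scalerA -expr2.
Qed.

(** If [c = al + i be] with [be] nonzero, then [h - c] is a factor of [(h - al) ^+ 2 + be ^+ 2],
    which is invertible. *)
Lemma spectrum_sa_real h c : star h = h -> spectrum h c -> complex.Im c = 0.
Proof.
case: c => al be hs hc; apply: contrapT => /eqP /= be0; apply: hc.
pose g := h - al%:C%:A.
have gs : star g = g by rewrite starB starZr star1 hs.
have -> : h - (al +i* be)%:A = g - ('i * be%:C)%:A.
  by rewrite [_ +i* _]complexE /= scalerDl opprD addrA.
have hcomm : GRing.comm (g - ('i * be%:C)%:A) (g + ('i * be%:C)%:A).
  apply: commrD; apply: commr_sym; apply: commrB;
  by [apply: commr_refl | apply: comm_scalar | apply/commr_sym/comm_scalar].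
apply: (invertible_commMl hcomm).
have -> : (g - ('i * be%:C)%:A) * (g + ('i * be%:C)%:A) = g ^+ 2 + (be ^+ 2)%:C%:A.
  by rewrite mul_conj_scalar exprMn sqr_i mulN1r -rmorphXn scaleNr opprK.
by apply: invertible_sqrD => //; rewrite exprn_even_gt0.
Qed.

(** For a complex square root [m] of [c], [b ^+ 2 - c = (b - m) * (b + m)], so [m] or [- m] is in
    the spectrum of [b] and is therefore real. *)
Lemma spectrum_sqr_ge0 b c : star b = b -> spectrum (b ^+ 2) c -> 0 <= c.
Proof.
move=> bs hc; rewrite -[c]sqr_sqrtc; set m := sqrtc c.
suff m0 : complex.Im m = 0.
  rewrite [m]complexE m0 mulr0 addr0 -rmorphXn ler0c; exact: sqr_ge0.
have [hm|hm] := pselect (invertible (b - m%:A)); last exact: (spectrum_sa_real bs).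
have [hm'|hm'] := pselect (invertible (b - (- m)%:A)).
  exfalso; apply: hc; have := invertibleM hm hm'.
  by rewrite scaleNr opprK mul_conj_scalar sqr_sqrtc.
have := spectrum_sa_real bs hm'; rewrite raddfN /=.
by move=> /eqP; rewrite oppr_eq0 => /eqP.
Qed.

(** Jacobson's formula: if [e] inverts [v * u - c], then [c^-1 *: (u * e * v - 1)] inverts
    [u * v - c]. *)
Lemma spectrum_mulC u v c : c != 0 -> spectrum (u * v) c -> spectrum (v * u) c.
Proof.
move=> c0 hc [e e1 e2]; apply: hc.
exists (c^-1 *: (u * e * v - 1)).
  rewrite -scalerAr mulrBr mulr1 mulrBl.
  have -> : u * v * (u * e * v) = u * (v * u * e) * v by rewrite !mulrA.
  have -> : v * u * e = 1 + c *: e.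
    by rewrite -e1 mulrBl -scalerAl mul1r subrK.
  rewrite mulrDr mulr1 mulrDl -scalerAr -!scalerAl mul1r addrK opprB addrC subrK.
  by rewrite scalerA mulVf // scale1r.
rewrite -scalerAl mulrBl mul1r mulrBr.
have -> : u * e * v * (u * v) = u * (e * (v * u)) * v by rewrite !mulrA.
have -> : e * (v * u) = 1 + c *: e.
  by rewrite -e2 mulrBr -scalerAr mulr1 subrK.
rewrite mulrDr mulr1 mulrDl -!scalerAr -!scalerAl mulr1 addrK opprB addrC subrK.
by rewrite scalerA mulVf // scale1r.
Qed.

End Positivity.

(** * Spectral mapping for polynomials *)

Section PolynomialCalculus.
Context {R : realType} {A : cstarAlgType R} (h : A).
Implicit Types (p q : {poly R[i]}) (c : R[i]) (r : R) (z : A).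

Local Notation N := (@cstar_norm R A).
Local Notation ev := (@horner_alg R[i] A h).
Local Notation conj_poly := (map_poly (fun c : R[i] => c^*%C)).

Lemma comm_ev z p : GRing.comm z h -> GRing.comm z (ev p).
Proof.
move=> zh; elim/poly_ind: p => [|p c IH]; first by rewrite rmorph0; exact: commr0.
rewrite rmorphD rmorphM /= horner_algX horner_algC.
by apply: commrD (comm_scalar _ _); apply: commrM IH zh.
Qed.

Lemma star_ev p : star h = h -> star (ev p) = ev (conj_poly p).
Proof.
move=> hs; elim/poly_ind: p => [|p c IH]; first by rewrite !rmorph0 star0.
rewrite !rmorphD !rmorphM /= map_polyX map_polyC /= !horner_algX !horner_algC.
rewrite starD starM starZ star1 IH hs; congr (_ + _).
by apply: comm_ev; apply: commr_refl.
Qed.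

(** With an empty spectrum, [h - t] vacuously has nonnegative spectrum and is a square [b ^+ 2]. For
    [t > N h], [t - h] is a square [d ^+ 2] as well. Their sum is 0, so [b = 0] and [h = t], which
    puts [t] in the spectrum. *)
Lemma spectrum_nonempty : star h = h -> exists c, spectrum h c.
Proof.
move=> hs; apply: contrapT => /forallNP nh.
pose t := N h + 1.
have t0 : 0 < t by have := norm_ge0 h; rewrite /t; lra.
have [||b [bs b2 bc]] := @sqrt_of_spectrum_ge0 R A (h - t%:C%:A).
- by rewrite starB starZr star1 hs.
- by move=> c hc; case: (nh (t%:C + c)); rewrite /spectrum /= scalerDl opprD addrA.
have [||d [ds d2 dc]] := @sqrt_of_norm_sub R A (t%:C%:A - h) t _ t0.
- by rewrite starB starZr star1 hs.
- by rewrite opprB addrC subrK /t lerDl.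
have bd : GRing.comm b d.
  apply: dc; apply: commr_sym; apply: bc; rewrite -(opprB h).
  by apply/commr_sym/commrN/commr_refl.
have := @norm_sumsq R A b d 0 bs ds bd.
rewrite b2 d2 addrA subrK subrr rmorph0 scale0r normr0 => /(_ erefl) b0.
apply: (nh t%:C); rewrite /spectrum /= -b2.
have -> : b = 0.
  by apply/eqP; rewrite -norm_eq0 -sqrf_eq0 eq_le b0 sqr_ge0.
rewrite expr0n /= => -[y]; rewrite mul0r => /esym/eqP; by rewrite oner_eq0.
Qed.

(** Over the algebraically closed field [R[i]], [p - c] splits into linear factors; if no root were
    in the spectrum, each factor would be invertible at [h], and so would their product. *)
Lemma spectrum_ev p c : star h = h -> spectrum (ev p) c ->
  exists2 s, spectrum h s & p.[s] = c.
Proof.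
(* When [p] is the constant [c] there are no roots, and any point of the nonempty spectrum
   serves. *)
move=> hs hc; have [q0|q0] := eqVneq (p - c%:P) 0.
  have [s sh] := spectrum_nonempty hs; exists s => //.
  by apply/eqP; rewrite -subr_eq0 -[X in _ - X](hornerC c s) -hornerN -hornerD q0 horner0.
apply: contrapT => hn; apply: hc.
have -> : ev p - c%:A = ev (p - c%:P) by rewrite rmorphB /= horner_algC.
have [rs rsE] := closed_field_poly_normal (p - c%:P).
have rsP s : s \in rs -> invertible (h - s%:A).
  move=> srs; apply: contrapT => hi; apply: hn; exists s => //.
  apply/eqP; rewrite -subr_eq0 -[X in _ - X](hornerC c s) -hornerN -hornerD.
  by rewrite rsE hornerZ mulf_eq0 -/(root _ _) root_prod_XsubC srs orbT.
rewrite rsE linearZ /= mulr_algl; apply: invertibleZ; first by rewrite lead_coef_eq0.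
elim: rs {rsE} rsP => [|s rs IH] rsP.
  by rewrite big_nil rmorph1; exists 1; rewrite mulr1.
rewrite big_cons rmorphM; apply: invertibleM; last first.
  by apply: IH => t trs; apply: rsP; rewrite inE trs orbT.
by rewrite rmorphB /= horner_algX horner_algC; apply: rsP; rewrite mem_head.
Qed.

Lemma ev_spectrum p c : spectrum h c -> spectrum (ev p) p.[c].
Proof.
move=> hc hi; apply: hc.
have /factor_theorem [q qE] : root (p - p.[c]%:P) c.
  by rewrite /root hornerD hornerN hornerC subrr.
have : ev p - p.[c]%:A = (h - c%:A) * ev q.
  rewrite -(horner_algC h) -rmorphB qE mulrC rmorphM /= rmorphB /=.
  by rewrite horner_algX horner_algC.
move=> E; move: hi; rewrite E; apply: invertible_commMl.
by apply/commr_sym/commrB; [apply/commr_sym/comm_ev/commr_refl|exact: comm_scalar].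
Qed.

(** On the real spectrum, [conj_poly p * p] takes the values [|p.[c]| ^+ 2], so it and its
    difference from [r ^+ 2] both evaluate to squares. These commute and add up to [r ^+ 2], and
    [norm_sumsq] applies. *)
Lemma norm_ev_le p r : star h = h ->
  (forall c, spectrum h c -> complex.Re `|p.[c]| <= r) -> N (ev p) <= r.
Proof.
move=> hs hp.
have hconj c : spectrum h c -> (conj_poly p).[c] = p.[c]^*%C.
  move=> hc; have cc : c^*%C = c.
    by case: c {hc} (spectrum_sa_real hs hc) => a b /= ->; rewrite oppr0.
  by rewrite -{1}cc horner_map.
have pp c : spectrum h c -> (conj_poly p * p).[c] = (complex.Re `|p.[c]| ^+ 2)%:C.
  by move=> hc; rewrite hornerM hconj // mulrC -sqr_normc rmorphXn /= -cnormE.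
have r0 : 0 <= r.
  have [c hc] := spectrum_nonempty hs; apply: le_trans (hp _ hc); exact: cnorm_ge0.
have sev : star (ev p) * ev p = ev (conj_poly p * p) by rewrite star_ev // rmorphM.
have sp : star (ev (conj_poly p * p)) = ev (conj_poly p * p).
  by rewrite -sev starM starK.
have [|b [bs b2 bc]] := @sqrt_of_spectrum_ge0 R A (ev (conj_poly p * p)) sp.
  move=> c /(spectrum_ev hs) [s hsp <-]; rewrite pp // ler0c; exact: sqr_ge0.
have [||d [ds d2 dc]] := @sqrt_of_spectrum_ge0 R A (ev ((r ^+ 2)%:C%:P - conj_poly p * p)).
- by rewrite rmorphB starB sp /= horner_algC starZr star1.
- move=> c /(spectrum_ev hs) [s hsp <-].
  rewrite hornerD hornerN hornerC pp // -rmorphB ler0c subr_ge0.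
  by rewrite ler_pXn2r ?nnegrE ?cnorm_ge0 //; apply: hp.
have bd : GRing.comm b d.
  apply: dc; apply: commr_sym; apply: bc; apply: comm_ev.
  by apply/commr_sym/comm_ev/commr_refl.
have := @norm_sumsq R A b d (r ^+ 2) bs ds bd.
rewrite b2 d2 -rmorphD addrC subrK /= horner_algC => /(_ erefl).
rewrite -norm_sa_sqr // b2 -sev cstar_norm_star ger0_norm ?sqr_ge0 //.
by rewrite ler_pXn2r ?nnegrE ?norm_ge0.
Qed.

End PolynomialCalculus.

(** * Polynomial approximation on compact real sets *)

Section Approximation.
Context {R : realType}.
Implicit Types (S : set R[i]) (F : R[i] -> R[i]) (T : set R) (G : R -> R[i]).

(** The radii of balls in [R[i]^o] are elements of [R[i]]; a positive one is real, which allows an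
    epsilon-delta form with radii in [R]. *)
Lemma continuous_onP S F : continuous_on S F <->
  forall c, S c -> forall e : R, 0 < e -> exists2 d : R, 0 < d &
    forall c', S c' -> complex.Re `|c' - c| < d -> complex.Re `|F c' - F c| < e.
Proof.
rewrite /continuous_on; split.
  move=> /subspace_continuousP cF c Sc e e0.
  have e0' : 0 < e%:C by rewrite realC_gt0.
  have /cvgrPdist_lt/(_ _ e0') := cF c Sc.
  rewrite /within /= => /(@nbhs_normP _ R[i]^o) [d /= d0 hd].
  have dE : d = (complex.Re d)%:C by rewrite RRe_real // gtr0_real.
  exists (complex.Re d); first by rewrite -realC_gt0 -dE.
  move=> c' Sc' cc'; rewrite -ltcR -cnormE distrC; apply: hd => //=.
  by rewrite distrC cnormE dE ltcR.
move=> h; apply/subspace_continuousP => c Sc; apply/cvgrPdist_lt => e e0.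
have eE : e = (complex.Re e)%:C by rewrite RRe_real // gtr0_real.
have [|d d0 hd] := h c Sc (complex.Re e); first by rewrite -realC_gt0 -eE.
rewrite /within /=; apply/(@nbhs_normP _ R[i]^o); exists d%:C => /=; first by rewrite realC_gt0.
move=> c' /= cc' Sc'; rewrite distrC cnormE eE ltcR; apply: hd => //.
by rewrite -ltcR -cnormE distrC.
Qed.

(* Uniform continuity and boundedness on a compact set, combined into the single
   estimate that Bernstein polynomials require. *)
Lemma compact_quadratic_modulus T G : compact T ->
  (forall t, T t -> forall e : R, 0 < e -> exists2 d : R, 0 < d &
    forall t', T t' -> `|t' - t| < d -> complex.Re `|G t' - G t| < e) ->
  forall e : R, 0 < e -> exists2 C : R, 0 <= C &
    forall t s, T t -> T s -> complex.Re `|G t - G s| <= e + C * (t - s) ^+ 2.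
Proof.
move=> cT cG e e0.
have := compact_setX cT cT => /compact_near_coveringP.
pose P (n : nat) (x : R * R) := T x.1 -> T x.2 ->
  complex.Re `|G x.1 - G x.2| <= e + n%:R * (x.1 - x.2) ^+ 2.
(* By compactness of [T * T] it suffices that, near each pair [(t0, s0)], the estimate holds for all
   large [n]; a common [n] then serves as [C]. *)
move=> /(_ _ \oo P _); case.
  move=> [t0 s0] [/= Tt Ts].
  have e2 : 0 < e / 2 by lra.
  have [d1 d10 h1] := cG _ Tt _ e2.
  have [d2 d20 h2] := cG _ Ts _ e2.
  set L := complex.Re `|G t0 - G s0|.
  have main t s : T t -> T s -> `|t - t0| < d1 -> `|s - s0| < d2 ->
      complex.Re `|G t - G s| <= e + L.
    move=> T1 T2 /(h1 _ T1) k1 /(h2 _ T2) k2.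
    have -> : G t - G s = (G t - G t0) + ((G t0 - G s0) - (G s - G s0)) by ring.
    have := cnormD (G t - G t0) ((G t0 - G s0) - (G s - G s0)).
    have := cnormD (G t0 - G s0) (- (G s - G s0)).
    rewrite normrN -/L; lra.
  have [r [k [r0 hr]]] : exists r k, 0 < r /\ forall t s n, `|t - t0| < r ->
      `|s - s0| < r -> (k <= n)%N -> P n (t, s).
    (* On the diagonal [L = 0] and continuity suffices. Off it, [|t - s|] stays at least half of
       [|t0 - s0|], so a large multiple of [(t - s) ^+ 2] absorbs [L]. *)
    have [ts|ts] := eqVneq t0 s0.
      exists (Num.min d1 d2), 0%N; rewrite lt_min d10 d20; split=> // t s n.
      rewrite !lt_min => /andP[a1 _] /andP[_ a2] _ /= T1 T2.
      have := main _ _ T1 T2 a1 a2.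
      rewrite /L ts subrr normr0 addr0 => /le_trans; apply.
      by rewrite lerDl mulr_ge0 ?sqr_ge0.
    pose de := `|t0 - s0| / 4.
    have de0 : 0 < de by rewrite divr_gt0 // normr_gt0 subr_eq0.
    exists (Num.min de (Num.min d1 d2)), (Num.truncn (L / (2 * de) ^+ 2)).+1.
    rewrite !lt_min d10 d20 de0; split=> // t s n.
    rewrite !lt_min => /and3P[a0 a1 _] /and3P[b0 _ b2] kn /= T1 T2.
    apply: le_trans (main _ _ T1 T2 a1 b2) _; rewrite lerD2l.
    have ts2 : 2 * de <= `|t - s|.
      have : `|t0 - s0| <= `|t - t0| + `|t - s| + `|s - s0|.
        have -> : t0 - s0 = - (t - t0) + (t - s) + (s - s0) by ring.
        apply: le_trans (ler_normD _ _) _; rewrite lerD2r -(normrN (t - t0)).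
        exact: ler_normD.
      have -> : `|t0 - s0| = 4 * de by rewrite /de; lra.
      lra.
    have sq : (2 * de) ^+ 2 <= (t - s) ^+ 2.
      rewrite -(real_normK (num_real (t - s))) ler_pXn2r ?nnegrE //.
      by rewrite mulr_ge0 // ltW.
    have q0 : 0 < (2 * de) ^+ 2 by rewrite exprn_gt0 // mulr_gt0.
    have : L / (2 * de) ^+ 2 <= n%:R.
      apply/ltW/(lt_le_trans (truncnS_gt _)); by rewrite ler_nat.
    rewrite ler_pdivrMr // => /le_trans; apply; exact: ler_wpM2l.
  exists ([set x | `|x.1 - t0| < r /\ `|x.2 - s0| < r], [set n | (k <= n)%N]) => /=.
    split; last by exists k.
    exists (ball t0 r, ball s0 r); first by split; apply: nbhsx_ballx.
    by move=> [t s] [/= bt bs]; split; rewrite distrC.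
  by move=> [[t s] n] [/= [a1 a2] kn]; apply: hr.
move=> n _ h; exists n%:R => // t s Tt Ts.
exact: (h n (leqnn n) (t, s)).
Qed.

Lemma compact_nearest T (x : R) : compact T -> T !=set0 ->
  exists2 s, T s & forall t, T t -> `|s - x| <= `|t - x|.
Proof.
move=> cT T0.
have [|s sT hs] := @compact_EVT_max R R (fun t => - `|t - x|) T T0 cT.
  apply: continuous_subspaceT => t; apply: cvgN; apply: cvg_norm.
  by apply: cvgB; [exact: cvg_id | exact: cvg_cst].
exists s; first by rewrite inE in sT.
by move=> t Tt; have := hs t; rewrite lerN2; apply; rewrite inE.
Qed.

(** The Bernstein polynomial, free of binomial coefficients, by conditioning on one trial with
    success probability [s]: a failure keeps [g], a success shifts it. *)
Fixpoint bernstein (s : {poly R[i]}) (n : nat) (g : nat -> R[i]) : {poly R[i]} :=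
  if n is n'.+1 then (1 - s) * bernstein s n' g + s * bernstein s n' (g \o succn)
  else (g 0%N)%:P.

(* The right-hand side is the expectation of the bound for [g k] when [k] is
   binomially distributed with parameters [n] and [t]. *)
Lemma bernstein_bound (s : {poly R[i]}) (c z : R[i]) (t al be : R) :
  s.[c] = t%:C -> 0 <= t <= 1 -> forall n g (x : R),
  (forall k, complex.Re `|g k - z| <= al + be * (k%:R - x) ^+ 2) ->
  complex.Re `|(bernstein s n g).[c] - z| <=
    al + be * (n%:R * (t * (1 - t)) + (n%:R * t - x) ^+ 2).
Proof.
move=> sc /andP[t0 t1]; have t1' : 0 <= 1 - t by rewrite subr_ge0.
elim=> [|n IH] g x hg.
  by rewrite hornerC !mul0r add0r; have := hg 0%N.
have h1 := IH g x hg.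
(* A success shifts the samples by one, so the centre [x] moves to [x - 1]; the variances then
   recombine. *)
have h2 : complex.Re `|(bernstein s n (g \o succn)).[c] - z| <=
    al + be * (n%:R * (t * (1 - t)) + (n%:R * t - (x - 1)) ^+ 2).
  apply: IH => k; apply: le_trans (hg _) _.
  by rewrite -natr1 opprB addrA.
rewrite [bernstein _ _ _]/= hornerD !hornerM hornerD hornerN sc hornerC.
set p := (bernstein s n g).[c] in h1 *.
set q := (bernstein s n (g \o succn)).[c] in h2 *.
have -> : (1 - t%:C) * p + t%:C * q - z = (1 - t)%:C * (p - z) + t%:C * (q - z).
  by rewrite rmorphB rmorph1; ring.
apply: le_trans (cnormD _ _) _; rewrite !cnormM !cnormr (ger0_norm t0) (ger0_norm t1').
rewrite -natr1; move: h1 h2; set u := complex.Re _; set v := complex.Re _ => h1 h2.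
have h1' : (1 - t) * u <= (1 - t) * (al + be * (n%:R * (t * (1 - t)) + (n%:R * t - x) ^+ 2)).
  by rewrite ler_wpM2l // subr_ge0.
have h2' := ler_wpM2l t0 h2.
apply: le_trans (lerD h1' h2') _; rewrite le_eqVlt; apply/orP; left; apply/eqP; ring.
Qed.

End Approximation.

Section Weierstrass.
Context {R : realType}.
Implicit Types (S : set R[i]) (F : R[i] -> R[i]).

Lemma weierstrass S F : (forall c, S c -> complex.Im c = 0) ->
  compact [set t : R | S t%:C] -> continuous_on S F ->
  forall e : R, 0 < e ->
  exists p : {poly R[i]}, forall c, S c -> complex.Re `|p.[c] - F c| <= e.
Proof.
move=> Sreal cT /continuous_onP cF e e0.
set T := [set t : R | S t%:C] in cT.
have SE c : S c -> c = (complex.Re c)%:C.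
  by move=> Sc; rewrite [LHS]complexE (Sreal _ Sc) mulr0 addr0.
have ST c : S c -> T (complex.Re c) by move=> Sc; rewrite /T /= -SE.
have [T0|/set0P/negP/negPn/eqP T0] := pselect (T !=set0); last first.
  by exists 0 => c /ST; rewrite T0.
have [M M0 TM] : exists2 M : R, 0 < M & forall t, T t -> `|t| <= M.
  have [M [_ TM]] := compact_bounded cT.
  exists (`|M| + 1); first by rewrite ltr_wpDl.
  by move=> t; apply: TM; apply: le_lt_trans (ler_norm M) _; rewrite ltrDl.
have e2 : 0 < e / 2 by lra.
have [|C C0 hC] := @compact_quadratic_modulus R T (fun t => F t%:C) cT _ _ e2.
  move=> t Tt d d0; have [r r0 hr] := cF _ Tt _ d0; exists r => // t' Tt' tt'.
  by apply: hr => //; rewrite -rmorphB cnormr.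
pose B := 4 * C * M ^+ 2.
have B0 : 0 <= B by rewrite mulr_ge0 ?sqr_ge0 // mulr_ge0.
pose n := (Num.truncn (2 * B / e)).+1.
have n0 : 0 < n%:R :> R by rewrite ltr0n.
have nB : 2 * B / n%:R <= e.
  by rewrite ler_pdivrMr // [e * _]mulrC -ler_pdivrMr //; apply/ltW/truncnS_gt.
(* [F] is controlled only on [S], so it is sampled not at the grid points [x k] of [[- M, M]] but at
   nearest points [sk k] of [T]; this at most doubles the distance to a point of [T]. *)
pose x (k : nat) : R := - M + 2 * M * (k%:R / n%:R).
have /choice [sk hsk] : forall k, exists s, T s /\ forall t, T t -> `|s - x k| <= `|t - x k|.
  by move=> k; have [s Ts hs] := compact_nearest (x k) cT T0; exists s.
pose s : {poly R[i]} := ('X + M%:C%:P) * ((2 * M)^-1)%:C%:P.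
exists (bernstein s n (fun k => F (sk k)%:C)) => c Sc.
set t := complex.Re c; have Tt : T t := ST _ Sc.
pose tau := (t + M) / (2 * M).
have sc : s.[c] = tau%:C.
  by rewrite hornerM hornerD hornerX !hornerC (SE _ Sc) -rmorphD -rmorphM.
have M20 : 0 < 2 * M by rewrite mulr_gt0.
have tau01 : 0 <= tau <= 1.
  have := TM _ Tt; rewrite ler_norml => /andP[h1 h2].
  by apply/andP; split; [apply: divr_ge0|rewrite ler_pdivrMr //]; lra.
have tE : t = 2 * M * tau - M by rewrite /tau mulrC divfK ?gt_eqF // addrK.
have hb k : complex.Re `|F (sk k)%:C - F c| <=
    e / 2 + 4 * C * (2 * M) ^+ 2 / n%:R ^+ 2 * (k%:R - n%:R * tau) ^+ 2.
  have [Ts hs] := hsk k.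
  rewrite (SE _ Sc) -/t; apply: le_trans (hC _ _ Ts Tt) _; rewrite lerD2l.
  have -> : 4 * C * (2 * M) ^+ 2 / n%:R ^+ 2 * (k%:R - n%:R * tau) ^+ 2 =
            C * (4 * (t - x k) ^+ 2).
    by rewrite tE /x; field; rewrite gt_eqF.
  rewrite ler_wpM2l //.
  have : `|sk k - t| <= 2 * `|t - x k|.
    have -> : sk k - t = (sk k - x k) - (t - x k) by ring.
    by have := ler_normB (sk k - x k) (t - x k); have := hs _ Tt; lra.
  rewrite -(real_normK (num_real (sk k - t))) -(real_normK (num_real (t - x k))).
  move=> hle; have : 4 * `|t - x k| ^+ 2 = (2 * `|t - x k|) ^+ 2 by ring.
  by move=> ->; rewrite ler_pXn2r ?nnegrE // mulr_ge0.
apply: le_trans (bernstein_bound sc tau01 n hb) _.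
rewrite subrr expr0n addr0.
have -> : 4 * C * (2 * M) ^+ 2 / n%:R ^+ 2 * (n%:R * (tau * (1 - tau))) =
   4 * (tau * (1 - tau)) * (B / n%:R) by rewrite /B; field; rewrite gt_eqF.
have h4 : 4 * (tau * (1 - tau)) <= 1 by have := sqr_ge0 (2 * tau - 1); lra.
have := ler_wpM2r (divr_ge0 B0 (ltW n0)) h4.
move: nB; rewrite -mulrA; lra.
Qed.

End Weierstrass.

(** * Continuous functional calculus of a self-adjoint element *)

Section FunctionalCalculus.
Context {R : realType} {A : cstarAlgType R} (h : A).
Hypothesis hs : star h = h.
Implicit Types (p q : {poly R[i]}) (c : R[i]) (r : R) (z L : A) (F G : R[i] -> R[i]).

Local Notation N := (@cstar_norm R A).
Local Notation ev := (@horner_alg R[i] A h).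
Local Notation conj_poly := (map_poly (fun c : R[i] => c^*%C)).

Lemma compact_real_spectrum : compact [set t : R | spectrum h t%:C].
Proof.
apply: (@subclosed_compact _ _ `[- N h, N h]); last 2 first.
- exact: segment_compact.
- by move=> t /= /spectrum_norm_le; rewrite cnormr in_itv /= -ler_norml.
(* The resolvent set is open: [h - t'] is [h - t] times a small perturbation of 1, invertible by the
   Neumann series. *)
rewrite -openC openE => t /= /contrapT [e e1 e2].
have Ne : 0 < N e + 1 by rewrite ltr_wpDl ?norm_ge0.
apply/nbhs_normP; exists (N e + 1)^-1; first by rewrite /= invr_gt0.
move=> t' /= tt'; apply.
have -> : h - t'%:C%:A = (h - t%:C%:A) * (1 - (t' - t)%:C *: e).
  rewrite mulrBr mulr1 -scalerAr e1 -addrA -opprD -scalerDl -rmorphD.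
  by rewrite [t + _]addrC subrK.
apply: invertibleM; first by exists e.
apply: neumann; rewrite norm_scaler distrC.
move: tt'; rewrite -(ltr_pM2r Ne) mulVf ?gt_eqF // mulrDr mulr1.
by apply: le_lt_trans; rewrite lerDl.
Qed.

(** A relation between [F] and its value [L], so that the algebraic rules are proved with arbitrary
    approximating polynomials rather than a chosen sequence. *)
Definition calculus_limit F L := forall e : R, 0 < e -> exists p,
  (forall c, spectrum h c -> complex.Re `|p.[c] - F c| <= e) /\ N (ev p - L) <= e.

Lemma norm_ev_sub_le p q r :
  (forall c, spectrum h c -> complex.Re `|p.[c] - q.[c]| <= r) ->
  N (ev p - ev q) <= r.
Proof.
move=> pq; rewrite -rmorphB; apply: norm_ev_le => // c hc.
by rewrite hornerD hornerN pq.
Qed.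

Lemma calculus_limit_uniq F L L' :
  calculus_limit F L -> calculus_limit F L' -> L = L'.
Proof.
move=> hL hL'; apply/subr0_eq/norm_le_eq0 => e e0.
have e4 : 0 < e / 4 by lra.
have [p [p1 p2]] := hL _ e4; have [q [q1 q2]] := hL' _ e4.
have pq : N (ev p - ev q) <= e / 4 + e / 4.
  apply: norm_ev_sub_le => c hc.
  have -> : p.[c] - q.[c] = (p.[c] - F c) + (- (q.[c] - F c)) by ring.
  by apply: le_trans (cnormD _ _) _; rewrite normrN lerD ?p1 ?q1.
have -> : L - L' = - (ev p - L) + ((ev p - ev q) + (ev q - L')).
  by rewrite opprB [X in _ = _ + X]subrKA subrKA.
apply: le_trans (cstar_normD _ _) _; rewrite normN.
have := cstar_normD (ev p - ev q) (ev q - L'); lra.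
Qed.

Lemma calculus_limit_exists F : continuous_on (spectrum h) F ->
  exists L, calculus_limit F L.
Proof.
move=> cF.
have He n : 0 < n.+1%:R^-1 :> R by rewrite invr_gt0.
have /choice [p hp] : forall n : nat, exists p, forall c, spectrum h c ->
    complex.Re `|p.[c] - F c| <= n.+1%:R^-1.
  move=> n; apply: weierstrass (He n) => //.
    by move=> c; apply: spectrum_sa_real.
  exact: compact_real_spectrum.
have small (e : R) : 0 < e -> exists m, forall n, (m <= n)%N -> n.+1%:R^-1 <= e :> R.
  move=> e0; exists (Num.truncn e^-1) => n mn.
  rewrite invf_ple ?posrE //; apply/ltW/(lt_le_trans (truncnS_gt _)).
  by rewrite ler_nat.
have [|L pL] := @cauchy_converges R A (fun n => ev (p n)).
  move=> e e0; have e2 : 0 < e / 2 by lra.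
  have [m hm] := small _ e2; exists m => n mn; apply: norm_ev_sub_le => c hc.
  have -> : (p n).[c] - (p m).[c] = ((p n).[c] - F c) + - ((p m).[c] - F c) by ring.
  apply: le_trans (cnormD _ _) _; rewrite normrN [leRHS]splitr.
  by rewrite lerD // (le_trans (hp _ _ hc)) // hm.
exists L => e e0.
have [m hm] := small _ e0; have [m' hm'] := pL _ e0.
exists (p (m + m')%N); split; last by apply: hm'; apply: leq_addl.
by move=> c hc; apply: le_trans (hp _ _ hc) (hm _ (leq_addr _ _)).
Qed.

Lemma calculus_limit_ev p F : (forall c, spectrum h c -> F c = p.[c]) ->
  calculus_limit F (ev p).
Proof.
move=> pF e e0; exists p; split; last by rewrite subrr norm0 ltW.
by move=> c hc; rewrite pF // subrr normr0 ltW.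
Qed.

Lemma calculus_limitD F G L L' : calculus_limit F L -> calculus_limit G L' ->
  calculus_limit (fun c => F c + G c) (L + L').
Proof.
move=> hL hL' e e0; have e2 : 0 < e / 2 by lra.
have [p [p1 p2]] := hL _ e2; have [q [q1 q2]] := hL' _ e2.
exists (p + q); split.
  move=> c hc; rewrite hornerD opprD addrACA.
  apply: le_trans (cnormD _ _) _; have := p1 _ hc; have := q1 _ hc; lra.
rewrite rmorphD opprD addrACA; apply: le_trans (cstar_normD _ _) _; lra.
Qed.

Lemma calculus_limitM F G L L' : calculus_limit F L -> calculus_limit G L' ->
  calculus_limit (fun c => F c * G c) (L * L').
Proof.
move=> hL hL' e e0.
(* Approximants with error 1 provide a bound [P] on [F] and [L], and a bound [Q] on [G] and [L']. *)
have [p0 [p01 p02]] := hL _ ltr01; have [q0 [q01 q02]] := hL' _ ltr01.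
have bnd p f l : (forall c, spectrum h c -> complex.Re `|p.[c] - f c| <= 1) ->
    N (ev p - l) <= 1 ->
    (forall c, spectrum h c -> complex.Re `|f c| <= N (ev p) + 1) /\ N l <= N (ev p) + 1.
  move=> h1 h2; split.
    move=> c hc; have -> : f c = p.[c] - (p.[c] - f c) by ring.
    apply: le_trans (cnormD _ _) _; rewrite normrN lerD ?h1 //.
    exact/spectrum_norm_le/ev_spectrum.
  have -> : l = ev p - (ev p - l) by rewrite opprB addrC subrK.
  by apply: le_trans (normB _ _) _; rewrite lerD.
have [F1 L1] := bnd _ _ _ p01 p02; have [G1 L1'] := bnd _ _ _ q01 q02.
set P := N (ev p0) + 1 in F1 L1; set Q := N (ev q0) + 1 in G1 L1'.
have P0 : 0 <= P by rewrite addr_ge0 ?norm_ge0.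
have Q0 : 0 <= Q by rewrite addr_ge0 ?norm_ge0.
have K0 : 0 < P + Q + 1 by lra.
(* With [d <= 1], the product of two errors is at most [d], and the total error at most
   [(P + Q + 1) * d <= e]. *)
pose d := Num.min 1 (e / (P + Q + 1)).
have d0 : 0 < d by rewrite lt_min ltr01 divr_gt0.
have d1 : d <= 1 by rewrite ge_min lexx.
have de : (P + Q + 1) * d <= e by rewrite mulrC -ler_pdivlMr // ge_min lexx orbT.
have arith (u v w t : R) : 0 <= u -> 0 <= v -> 0 <= w -> 0 <= t ->
    u <= d -> v <= d -> w <= P -> t <= Q -> u * v + (u * t + w * v) <= e.
  move=> u0 v0 w0 t0 ud vd wP tQ; apply: le_trans de.
  have -> : (P + Q + 1) * d = d * 1 + (d * Q + P * d) by ring.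
  by rewrite !lerD // ler_pM // (le_trans vd).
have [p [p1 p2]] := hL _ d0; have [q [q1 q2]] := hL' _ d0.
exists (p * q); split.
  move=> c hc; rewrite hornerM.
  have -> : p.[c] * q.[c] - F c * G c =
    (p.[c] - F c) * (q.[c] - G c) + ((p.[c] - F c) * G c + F c * (q.[c] - G c)) by ring.
  apply: le_trans (cnormD _ _) _; rewrite cnormM.
  apply: le_trans (lerD (lexx _) (cnormD _ _)) _; rewrite !cnormM.
  by apply: arith; rewrite ?cnorm_ge0 ?p1 ?q1 ?F1 ?G1.
rewrite rmorphM.
have -> : ev p * ev q - L * L' =
    (ev p - L) * (ev q - L') + ((ev p - L) * L' + L * (ev q - L')).
  by rewrite addrA -mulrDr subrK mulrBl mulrBr subrKA.
apply: le_trans (cstar_normD _ _) _.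
apply: le_trans (lerD (cstar_normM _ _) (cstar_normD _ _)) _.
apply: le_trans (lerD (lexx _) (lerD (cstar_normM _ _) (cstar_normM _ _))) _.
by apply: arith; rewrite ?norm_ge0.
Qed.

Lemma calculus_limitZ (k : R[i]) F L : calculus_limit F L ->
  calculus_limit (fun c => k * F c) (k *: L).
Proof.
move=> hL; have -> : k *: L = ev k%:P * L by rewrite horner_algC mulr_algl.
apply: (calculus_limitM _ hL) => e e0; exists k%:P; split.
  by move=> c _; rewrite hornerC subrr normr0 ltW.
by rewrite subrr norm0 ltW.
Qed.

Lemma calculus_limit_star F L : calculus_limit F L ->
  calculus_limit (fun c => (F c)^*%R) (star L).
Proof.
move=> hL e e0; have [p [p1 p2]] := hL _ e0.
exists (conj_poly p); split; last by rewrite -star_ev // -starB norm_star.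
move=> c hc; have cc : c^*%C = c.
  by case: c {hc} (spectrum_sa_real hs hc) => a b /= ->; rewrite oppr0.
rewrite -{1}cc horner_map -rmorphB -[_ (_ - _)]/((p.[c] - F c)^*%C) normcJ.
exact: p1.
Qed.

Lemma functional_calculus_exists : exists Phi, is_functional_calculus h Phi.
Proof.
pose Phi F := xget 0 [set L | calculus_limit F L].
have PhiE F L : calculus_limit F L -> Phi F = L.
  move=> hL; apply: calculus_limit_uniq (hL).
  by apply: (@xgetPex _ 0 [set L | calculus_limit F L]); exists L.
have PhiP F : continuous_on (spectrum h) F -> calculus_limit F (Phi F).
  by move=> /calculus_limit_exists [L hL]; rewrite (PhiE _ _ hL).
exists Phi; split.
- move=> F G cF cG FG; apply: PhiE => e e0.
  have [p [p1 p2]] := PhiP _ cG _ e0; exists p; split=> // c hc.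
  by rewrite FG ?inE //; apply: p1.
- by apply: PhiE; rewrite -(rmorph1 ev); apply: calculus_limit_ev => c _; rewrite hornerC.
- by move=> F G cF cG; apply: PhiE; apply: calculus_limitD; apply: PhiP.
- by move=> F G cF cG; apply: PhiE; apply: calculus_limitM; apply: PhiP.
- by move=> k F cF; apply: PhiE; apply: calculus_limitZ; apply: PhiP.
- by move=> F cF; apply: PhiE; apply: calculus_limit_star; apply: PhiP.
- apply: PhiE; have := @calculus_limit_ev 'X id; rewrite horner_algX; apply=> c _.
  by rewrite hornerX.
Qed.

Lemma functional_calculusP : is_functional_calculus h (functional_calculus h).
Proof.
have [Phi hPhi] := functional_calculus_exists.
by apply: (@xgetPex _ (fun=> 0) [set Phi | is_functional_calculus h Phi]); exists Phi.
Qed.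

End FunctionalCalculus.

(** * Positivity of [x * star x] *)

Section RealCalculus.
Context {R : realType} {A : cstarAlgType R}.
Implicit Types (g : R -> R) (D : set R) (x h : A) (r : R).

Local Notation N := (@cstar_norm R A).

Lemma continuous_on_Re (S : set R[i]) D g : (forall c, S c -> D (complex.Re c)) ->
  {within D, continuous g} -> continuous_on S (fun c => (g (complex.Re c))%:C).
Proof.
move=> SD /subspace_continuousP cg; apply/continuous_onP => c Sc e e0.
have /cvgrPdist_lt/(_ _ e0)/nbhs_normP [d d0 hd] := cg _ (SD _ Sc).
exists d; first exact: d0.
move=> c' Sc' cc'; rewrite -rmorphB cnormr distrC; apply: hd; last exact: SD.
rewrite /= distrC; apply: le_lt_trans cc'; rewrite -raddfB -lecR -cnormE.
exact: normc_ge_Re.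
Qed.

(** * Calculus with real functions continuous on a set [D] containing the spectrum *)

Section SelfAdjoint.
Variables (h : A) (D : set R).
Hypotheses (hs : star h = h) (hD : forall c, spectrum h c -> D (complex.Re c)).

Let Phi := functional_calculus h.
Let PhiP : is_functional_calculus h Phi := functional_calculusP hs.
Let spectrum_real c : spectrum h c -> c = (complex.Re c)%:C.
Proof.
by move=> hc; rewrite [LHS]complexE (spectrum_sa_real hs hc) mulr0 addr0.
Qed.

Lemma real_calculus_ext g1 g2 : {within D, continuous g1} -> {within D, continuous g2} ->
  (forall t, D t -> g1 t = g2 t) -> real_calculus g1 h = real_calculus g2 h.
Proof.
move=> c1 c2 g12; apply: (calculus_ext PhiP); try exact: (continuous_on_Re hD).
by move=> c; rewrite inE => hc; rewrite g12 //; apply: hD.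
Qed.

Lemma real_calculus_id : real_calculus id h = h.
Proof.
rewrite -[RHS](calculus_id PhiP); apply: (calculus_ext PhiP).
- apply: (@continuous_on_Re _ D id hD).
  by apply: continuous_subspaceT => t; apply: cvg_id.
- by apply/continuous_onP => c _ e e0; exists e.
- by move=> c; rewrite inE => hc; rewrite -spectrum_real.
Qed.

Lemma real_calculusD g1 g2 : {within D, continuous g1} -> {within D, continuous g2} ->
  real_calculus (fun t => g1 t + g2 t) h = real_calculus g1 h + real_calculus g2 h.
Proof.
move=> c1 c2; rewrite -(calculusD PhiP); try exact: (continuous_on_Re hD).
by congr (Phi _); apply/funext => c; rewrite rmorphD.
Qed.

Lemma real_calculusM g1 g2 : {within D, continuous g1} -> {within D, continuous g2} ->
  real_calculus (fun t => g1 t * g2 t) h = real_calculus g1 h * real_calculus g2 h.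
Proof.
move=> c1 c2; rewrite -(calculusM PhiP); try exact: (continuous_on_Re hD).
by congr (Phi _); apply/funext => c; rewrite rmorphM.
Qed.

Lemma real_calculusZ r g : {within D, continuous g} ->
  real_calculus (fun t => r * g t) h = r%:C *: real_calculus g h.
Proof.
move=> c1; rewrite -(calculusZ PhiP); try exact: (continuous_on_Re hD).
by congr (Phi _); apply/funext => c; rewrite rmorphM.
Qed.

Lemma real_calculus1 : real_calculus (fun=> 1) h = 1.
Proof. exact: (calculus1 PhiP). Qed.

Lemma real_calculus_star g : {within D, continuous g} ->
  star (real_calculus g h) = real_calculus g h.
Proof.
move=> c1; rewrite -(calculus_star PhiP); try exact: (continuous_on_Re hD).
by congr (Phi _); apply/funext => c; apply: conjc_real.
Qed.

Lemma real_calculus_sqr g : {within D, continuous g} -> (forall t, D t -> 0 <= g t) ->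
  exists b, [/\ star b = b, b ^+ 2 = real_calculus g h & GRing.comm h b].
Proof.
move=> cg g0.
have cs : {within D, continuous (fun t => Num.sqrt (g t))}.
  move/subspace_continuousP in cg; apply/subspace_continuousP => t Dt.
  by apply: cvg_comp (cg t Dt) _; exact: sqrt_continuous.
exists (real_calculus (fun t => Num.sqrt (g t)) h).
have cid : {within D, continuous (fun t : R => t)}.
  by apply: continuous_subspaceT => t; exact: cvg_id.
split; first exact: real_calculus_star; last first.
  rewrite /GRing.comm -{1 4}real_calculus_id -!real_calculusM //.
  by congr (real_calculus _ h); apply/funext => t; rewrite mulrC.
rewrite expr2 -real_calculusM //; apply: real_calculus_ext => //.
- move/subspace_continuousP in cs; apply/subspace_continuousP => t Dt.
  by apply: cvgM; apply: cs.
- by move=> t Dt; rewrite -expr2 sqr_sqrtr // g0.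
Qed.

End SelfAdjoint.

(** Up to sign, [p] and [q] are the real and imaginary parts of [x] multiplied by the square root of
    2. *)
Lemma star_mul_self_add x : exists p q, [/\ star p = p, star q = q &
  star x * x + x * star x = p ^+ 2 + q ^+ 2].
Proof.
pose s : R[i] := (Num.sqrt 2^-1)%:C.
have s2 : s ^+ 2 = 2^-1.
  by rewrite -rmorphXn /= sqr_sqrtr ?invr_ge0 // fmorphV rmorph_nat.
have sc : (s * 'i)^*%R = - (s * 'i).
  apply/eqP; rewrite eq_complex /=.
  by rewrite !mulr0 !mul0r !mulr1 !addr0 subrr oppr0 !eqxx.
exists (s *: (x + star x)), ((s * 'i) *: (x - star x)); split.
- by rewrite starZr starD starK addrC.
- by rewrite starZ starB starK sc scaleNr -scalerN opprB.
rewrite !exprZn exprMn sqr_i mulrN1 scaleNr s2 -scalerBr.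
have -> : (x + star x) ^+ 2 - (x - star x) ^+ 2 =
    (star x * x + x * star x) *+ 2.
  set y := star x.
  have -> : (x + y) ^+ 2 = (x * x + y * y) + (y * x + x * y).
    by rewrite expr2 mulrDl !mulrDr [LHS]addrACA [RHS]addrACA [y * y + _]addrC.
  have -> : (x - y) ^+ 2 = (x * x + y * y) - (y * x + x * y).
    by rewrite expr2 mulrBl !mulrBr opprB [LHS]addrACA -opprD [x * y + _]addrC.
  by rewrite opprB addrC subrKA.
by rewrite -[(_ + _) *+ 2]scaler_nat scalerA mulVf // scale1r.
Qed.

Lemma max0_continuous D g : continuous g ->
  {within D, continuous (fun t => Num.max 0 (g t))}.
Proof.
by move=> cg; apply: continuous_subspaceT => t; apply: continuous_max;
  [apply: cst_continuous | apply: cg].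
Qed.

(* With [m] the negative part of [h := x * star x] and [n ^+ 2 = m], the element
   [u := n * x] satisfies [u * star u = - m ^+ 2]; since [star u * u] has the same
   nonzero spectrum and [star u * u + u * star u] is a sum of squares, [m = 0]. *)
Lemma spectrum_mul_star_ge0 x c : spectrum (x * star x) c -> 0 <= c.
Proof.
set h := x * star x.
have hs : star h = h by rewrite starM starK.
have hT : forall c, spectrum h c -> setT (complex.Re c) by [].
have cneg : {within setT, continuous (fun t : R => Num.max 0 (- t))}.
  by apply: max0_continuous; exact: opp_continuous.
have cpos : {within setT, continuous (fun t : R => Num.max 0 t)}.
  by apply: max0_continuous => t; exact: cvg_id.
have cid : {within setT, continuous (fun t : R => t)}.
  by apply: continuous_subspaceT => t; exact: cvg_id.
set m := real_calculus (fun t => Num.max 0 (- t)) h.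
have ms : star m = m by apply: real_calculus_star hT _ cneg.
have [n [ns n2 hn]] : exists n, [/\ star n = n, n ^+ 2 = m & GRing.comm h n].
  by apply: (real_calculus_sqr hs hT) => // t _; rewrite le_max lexx.
have mh : m * h = - m ^+ 2.
  rewrite -{1}(real_calculus_id hs hT) -(real_calculusM hs hT) //.
  rewrite expr2 -(real_calculusM hs hT) // -scaleN1r -(rmorphN1 (real_complex R)).
  rewrite -(real_calculusZ hs hT); last by move=> t; apply: cvgM; apply: cneg.
  apply: (real_calculus_ext hs hT) => [||t _].
  - by move=> t; apply: cvgM; [apply: cneg|apply: cid].
  - by move=> t; apply: cvgM; [apply: cst_continuous|apply: cvgM; apply: cneg].
  - by case: (leP 0 (- t)) => ht; rewrite ?mul0r ?mulr0 //; ring.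
have uu : n * x * star (n * x) = - m ^+ 2.
  rewrite starM ns mulrA -(mulrA n x) -/h -mulrA hn mulrA -expr2 n2; exact: mh.
have [p [q [ps qs pq]]] := star_mul_self_add (n * x).
(* [d ^+ 2] is [star u * u + u * star u]; adding [m ^+ 2 = - (u * star u)] shows that [star u * u]
   is the square of a self-adjoint element. *)
have [d [ds d2]] := sum_sqr ps qs.
have [e [es e2]] := sum_sqr ds ms.
have {}e2 : e ^+ 2 = star (n * x) * (n * x).
  by rewrite e2 d2 -pq uu subrK.
have uus : star (- m ^+ 2) = - m ^+ 2 by rewrite starN starX ms.
have [|b [bs b2 bc]] := sqrt_of_spectrum_ge0 uus.
  move=> k; rewrite -uu; have [->//|k0] := eqVneq k 0.
  by move=> /(spectrum_mulC k0); rewrite -e2; apply: spectrum_sqr_ge0.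
have m0 : m = 0.
  have mb : GRing.comm m b.
    by apply: bc; apply/commrN/commrX/commr_refl.
  have := @norm_sumsq R A m b 0 ms bs mb.
  rewrite b2 subrr rmorph0 scale0r normr0 => /(_ erefl) h0.
  by apply/eqP; rewrite -norm_eq0 -sqrf_eq0 eq_le h0 sqr_ge0.
(* Since the negative part vanishes, [h] equals its positive part, which is a square. *)
have hE : real_calculus (fun t => Num.max 0 t) h = h.
  rewrite -[RHS]addr0 -m0 -{2}(real_calculus_id hs hT) -(real_calculusD hs hT) //.
  apply: (real_calculus_ext hs hT) => // [|t _].
    by move=> t; apply: cvgD; [apply: cid|apply: cneg].
  by case: (leP 0 t) => ht; case: (leP 0 (- t)) => ht' //; lra.
have [|k [ks k2 _]] := real_calculus_sqr hs hT cpos.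
  by move=> t _; rewrite le_max lexx.
rewrite hE in k2.
by rewrite -k2; apply: spectrum_sqr_ge0.
Qed.

End RealCalculus.

(** * Positive functionals *)

Section PositiveFunctionals.
Context {R : realType} {A : cstarAlgType R} (f : {linear A -> R[i]^o}).
Hypothesis f_pos : forall x : A, 0 <= f (star x * x).
Implicit Types (x y u v w : A) (r : R).

Local Notation N := (@cstar_norm R A).
Local Notation fr x := (complex.Re (f x : R[i])).

(** The choice [t = g^-1] minimizes the quadratic. If [g = 0], it is affine in [t] and takes the
    value -1 at [t = (a + 1) / (2 * s)] unless [s = 0]. *)
Lemma quadratic_ge0 (a s g : R) : 0 <= g -> 0 <= s ->
  (forall t, 0 <= a - 2 * t * s + t ^+ 2 * s * g) -> s <= a * g.
Proof.
move=> g0 s0 h; have [gE|gN] := eqVneq g 0.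
  have := h ((a + 1) / (2 * s)); rewrite gE !mulr0 addr0.
  have [-> _|sN] := eqVneq s 0; first by [].
  have -> : 2 * ((a + 1) / (2 * s)) * s = a + 1 by field.
  lra.
have gp : 0 < g by rewrite lt_neqAle eq_sym gN.
have := h g^-1.
have -> : a - 2 * g^-1 * s + g^-1 ^+ 2 * s * g = (a * g - s) / g by field.
by rewrite pmulr_lge0 ?invr_gt0 // subr_ge0.
Qed.

Lemma functionalZ (k : R[i]) x : f (k *: x) = k * f x :> R[i].
Proof. exact: linearZ. Qed.

Lemma functionalD x y : f (x + y) = f x + f y :> R[i].
Proof. exact: raddfD. Qed.

Lemma functionalN x : f (- x) = - f x :> R[i].
Proof. exact: raddfN. Qed.

Lemma functional_mul_starE x : f (star x * x) = (fr (star x * x))%:C :> R[i].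
Proof. by rewrite RRe_real // ger0_real. Qed.

Lemma functional_mul_star_ge0 x : 0 <= fr (star x * x).
Proof. by rewrite -ler0c -functional_mul_starE. Qed.

(** The values of [f] at the squares of [x + 1] and [x + i] are real; their imaginary parts fix
    those of [f x + f (star x)] and of [i (f (star x) - f x)]. *)
Lemma functional_star x : f (star x) = (f x : R[i])^*%C :> R[i].
Proof.
have h1 := ger0_Im (f_pos (x + 1)).
have h2 := ger0_Im (f_pos (x + 'i%:A)).
have hx := ger0_Im (f_pos x); have h0 := ger0_Im (f_pos 1).
rewrite star1 mulr1 in h0.
have E1 : f (star (x + 1) * (x + 1)) = f (star x * x) + f (star x) + f x + f 1.
  by rewrite starD star1 mulrDr mulr1 mulrDl mul1r -!raddfD /= !addrA [_ + x + _]addrAC.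
have E2 : f (star (x + 'i%:A) * (x + 'i%:A)) =
    f (star x * x) + 'i * f (star x) - 'i * f x + f 1.
  have ci : 'i^*%R = - 'i :> R[i] by apply/eqP; rewrite eq_complex /= oppr0 !eqxx.
  have -> : star (x + 'i%:A) * (x + 'i%:A) = star x * x + 'i *: star x - 'i *: x + 1.
    rewrite starD starZ star1 ci mulrDr !mulrDl -!scalerAl -!scalerAr !mul1r !mulr1.
    rewrite scalerA mulNr -expr2 sqr_i opprK scale1r scaleNr !addrA.
    by rewrite [_ - _ + _]addrAC.
  by rewrite !functionalD functionalN !functionalZ.
rewrite E1 in h1; rewrite E2 in h2.
move: h1 h2 hx h0.
case: (f (star x * x)) (f (star x)) (f x) (f 1) => [a b] [c d] [e g] [k l] /=.
move=> h1 h2 hx h0; congr (_ +i* _); lra.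
Qed.

Lemma cauchy_schwarz u v :
  complex.Re `|f (star u * v)| ^+ 2 <= fr (star u * u) * fr (star v * v).
Proof.
apply: quadratic_ge0 => [||t]; rewrite ?functional_mul_star_ge0 ?sqr_ge0 //.
set s : R[i] := f (star u * v).
(* The factor conjugate to [s] makes the cross terms real, leaving a real quadratic in [t]. *)
pose la : R[i] := - (t%:C * s^*%C).
have := f_pos (u + la *: v).
have -> : f (star (u + la *: v) * (u + la *: v)) =
   (fr (star u * u) - 2 * t * complex.Re `|s| ^+ 2 +
    t ^+ 2 * complex.Re `|s| ^+ 2 * fr (star v * v))%:C :> R[i].
  have -> : star (u + la *: v) * (u + la *: v) =
      star u * u + la *: (star u * v) + la^*%C *: (star v * u) +
      (la^*%C * la) *: (star v * v).
    rewrite starD starZ mulrDr !mulrDl -!scalerAl -!scalerAr scalerA !addrA.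
    by rewrite [_ + _ + la *: (star u * v)]addrAC.
  have vu : f (star v * u) = s^*%C :> R[i].
    by rewrite -functional_star starM starK.
  have := functional_mul_starE u; have := functional_mul_starE v.
  set be := fr (star v * v); set al := fr (star u * u) => vE uE.
  rewrite !functionalD !functionalZ uE vE vu -/s.
  have ss : (complex.Re `|s| ^+ 2)%:C = s * s^*%C by rewrite rmorphXn /= -cnormE sqr_normc.
  have lac : la^*%C = - (t%:C * s).
    rewrite /la; case: (s) => p q; apply/eqP; rewrite eq_complex /=.
    by apply/andP; split; apply/eqP; ring.
  move: (complex.Re `|s| ^+ 2) ss => sg ss.
  rewrite lac rmorphD rmorphB !rmorphM /= ss /la rmorph_nat; ring.
by rewrite ler0c.
Qed.

(** [N x ^+ 2 - star x * x] is a square [g ^+ 2], and [f] is nonnegative at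
    [star (g * y) * (g * y)]. *)
Lemma functional_mul_star_le x y :
  fr (star y * (star x * x) * y) <= N x ^+ 2 * fr (star y * y).
Proof.
have [->|x0] := eqVneq x 0.
  by rewrite mulr0 mulr0 mul0r raddf0 norm0 expr0n mul0r.
have r0 : 0 < N x ^+ 2 by rewrite exprn_gt0 // norm_gt0.
have [||g [gs g2 _]] := @sqrt_of_norm_sub R A ((N x ^+ 2)%:C%:A - star x * x) _ _ r0.
- by rewrite starB starZr star1 starM starK.
- by rewrite opprB addrC subrK cstar_norm_star.
have := functional_mul_star_ge0 (g * y).
rewrite starM gs mulrA -(mulrA _ g g) -expr2 g2 mulrBr mulrBl -scalerAr mulr1.
rewrite -scalerAl functionalD functionalN functionalZ.
move: (f _) (f _) => [a b] [c d] /=; lra.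
Qed.

Lemma functional_le w : complex.Re `|f w| <= fr 1 * N w.
Proof.
have f1 : 0 <= fr 1 by have := functional_mul_star_ge0 1; rewrite star1 mulr1.
have := cauchy_schwarz 1 w; rewrite star1 !mul1r => h.
have := functional_mul_star_le w 1; rewrite star1 !mul1r !mulr1 => h2.
rewrite -(@ler_pXn2r _ 2) ?nnegrE ?cnorm_ge0 ?mulr_ge0 ?norm_ge0 //.
apply: le_trans h _; rewrite exprMn [_ ^+ 2 in leRHS]expr2 -mulrA mulrC.
rewrite [leRHS]mulrC ler_wpM2r //; by rewrite mulrC.
Qed.

Lemma functional_mul_star_mid x y z :
  complex.Re `|f (x * y * star z)| <=
    N y / 2 * (fr (x * star x) + fr (z * star z)).
Proof.
have Ny := norm_ge0 y.
have := cauchy_schwarz (star x) (y * star z).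
have := functional_mul_star_le y (star z).
have := functional_mul_star_ge0 (star x); have := functional_mul_star_ge0 (star z).
rewrite starM !starK !mulrA.
move: (fr (x * _)) (fr (z * star z)) (fr (z * star y * y * star z)) => a b c b0 a0 cb h.
rewrite -(@ler_pXn2r _ 2) ?nnegrE ?cnorm_ge0 //; last first.
  by rewrite mulr_ge0 ?addr_ge0 ?divr_ge0.
apply: le_trans h _; apply: le_trans (ler_wpM2l a0 cb) _.
rewrite -subr_ge0.
(* The arithmetic-geometric inequality: the difference of the two sides is a square. *)
have -> : (N y / 2 * (a + b)) ^+ 2 - a * (N y ^+ 2 * b) = (N y / 2 * (a - b)) ^+ 2 by field.
exact: sqr_ge0.
Qed.

End PositiveFunctionals.

(** * Convexity of Orlicz functions and support lines *)

Section Orlicz.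
Context {R : realType} (phi : R -> R).
Hypothesis phiO : orlicz_function phi.
Implicit Types (s t u : R).

Lemma orlicz_conv (la s t : R) : 0 <= la <= 1 -> 0 <= s -> 0 <= t ->
  phi (la * s + (1 - la) * t) <= la * phi s + (1 - la) * phi t.
Proof.
move=> /andP[la0 la1] s0 t0.
have := orlicz_convex phiO (Itv01 la0 la1) (x := s) (y := t).
by rewrite !convRE /=; apply; rewrite inE /= in_itv /= andbT.
Qed.

Lemma orlicz_chord s t0 t : 0 <= s -> s < t0 -> t0 < t ->
  (phi t0 - phi s) / (t0 - s) <= (phi t - phi t0) / (t - t0).
Proof.
move=> s0 st0 t0t.
have st : 0 < t - s by lra.
have la01 : 0 <= (t - t0) / (t - s) <= 1.
  by apply/andP; split; [apply: divr_ge0|rewrite ler_pdivrMr //]; lra.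
have tge : 0 <= t by lra.
have := orlicz_conv la01 s0 tge.
have -> : (t - t0) / (t - s) * s + (1 - (t - t0) / (t - s)) * t = t0.
  by field; rewrite gt_eqF.
have -> : (t - t0) / (t - s) * phi s + (1 - (t - t0) / (t - s)) * phi t =
   ((t - t0) * phi s + (t0 - s) * phi t) / (t - s).
  by field; rewrite gt_eqF.
rewrite ler_pdivlMr // => h.
rewrite ler_pdivrMr ?subr_gt0 // mulrAC ler_pdivlMr ?subr_gt0 //; lra.
Qed.

(** At [t0 > 0] the slope is the supremum of the slopes of chords ending at [t0], which every chord
    starting there bounds from above. At 0 the horizontal line works. *)
Lemma orlicz_support_line t0 : 0 <= t0 ->
  exists c, forall t, 0 <= t -> phi t0 + c * (t - t0) <= phi t.
Proof.
rewrite le_eqVlt => /predU1P[<-|t00].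
  by exists 0 => t t0'; rewrite (orlicz0 phiO) mul0r addr0 (orlicz_ge0 phiO).
pose E := [set (phi t0 - phi s) / (t0 - s) | s in [set s | 0 <= s < t0]].
have E0 : E !=set0 by exists ((phi t0 - phi 0) / (t0 - 0)), 0 => //=; rewrite lexx.
have Eub t : t0 < t -> ubound E ((phi t - phi t0) / (t - t0)).
  by move=> t0t _ [s /= /andP[s0 st0] <-]; apply: orlicz_chord.
have hs : has_sup E.
  by split=> //; exists ((phi (t0 + 1) - phi t0) / (t0 + 1 - t0)); apply: Eub; lra.
exists (sup E) => t tge; case: (ltgtP t t0) => [tt0|t0t|->]; last first.
- by rewrite subrr mulr0 addr0.
- have : sup E <= (phi t - phi t0) / (t - t0) by apply: ge_sup => //; apply: Eub.
  by rewrite ler_pdivlMr ?subr_gt0 //; lra.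
- have : (phi t0 - phi t) / (t0 - t) <= sup E.
    by apply: ub_le_sup; [exact: hs.2|exists t => //=; rewrite tge].
  rewrite ler_pdivrMr ?subr_gt0 //; lra.
Qed.

End Orlicz.

(** * Jensen's inequality for states, and part (b) *)

Section Jensen.
Context {R : realType} {A : cstarAlgType R}.
Implicit Types (x y z h : A) (phi : R -> R).

Local Notation N := (@cstar_norm R A).

(** [phi] minus its support line at [t0 = f h] is nonnegative on the half-line, so its value at [h]
    is a square, where [f] is nonnegative; since [f 1 = 1], the slope term vanishes under [f]. *)
Lemma jensen (f : {linear A -> R[i]^o}) phi h : orlicz_function phi ->
  (forall x, 0 <= f (star x * x)) -> f 1 = 1 -> star h = h ->
  (forall c, spectrum h c -> 0 <= c) ->
  0 <= complex.Re (f h : R[i]) /\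
  phi (complex.Re (f h : R[i])) <= complex.Re (f (real_calculus phi h) : R[i]).
Proof.
move=> phiO fpos f1 hs hpos.
have t00 : 0 <= complex.Re (f h : R[i]).
  have [b [bs b2 _]] := sqrt_of_spectrum_ge0 hs hpos.
  by rewrite -b2 expr2 -{1}bs; apply: functional_mul_star_ge0.
split => //; set t0 := complex.Re _ in t00 *.
have [c hc] := orlicz_support_line phiO t00.
have hD k : spectrum h k -> `[0, +oo[%classic (complex.Re k).
  by move=> /hpos; rewrite lecE => /andP[_]; rewrite /= in_itv /= andbT.
have cphi := orlicz_continuous phiO.
have c1 : {within `[0, +oo[, continuous (fun _ : R => 1 : R)}.
  by apply: continuous_subspaceT => t; apply: cvg_cst.
have cid : {within `[0, +oo[, continuous (fun t : R => t)}.
  by apply: continuous_subspaceT => t; apply: cvg_id.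
have cl : {within `[0, +oo[, continuous (fun t : R => (c * t0 - phi t0) * 1 + - c * t)}.
  by apply: continuous_subspaceT => t; apply: cvgD; apply: cvgM;
    (apply: cvg_cst || apply: cvg_id).
have cl1 : {within `[0, +oo[, continuous (fun t : R => (c * t0 - phi t0) * 1)}.
  by apply: continuous_subspaceT => t; apply: cvg_cst.
have cl2 : {within `[0, +oo[, continuous (fun t : R => - c * t)}.
  by apply: continuous_subspaceT => t; apply: cvgM; (apply: cvg_cst || apply: cvg_id).
have cg : {within `[0, +oo[, continuous
    (fun t : R => phi t + ((c * t0 - phi t0) * 1 + - c * t))}.
  by move=> t; apply: cvgD; [apply: cphi|apply: cl].
have [|b [bs b2 _]] := real_calculus_sqr hs hD cg.
  by move=> t /=; rewrite in_itv /= andbT => /hc; lra.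
have := functional_mul_star_ge0 fpos b.
rewrite bs -expr2 b2 !(real_calculusD hs hD) // !(real_calculusZ hs hD) //.
rewrite real_calculus1 // (real_calculus_id hs hD) !functionalD !functionalZ f1.
rewrite /t0; move: (f h) (f _) => [p q] [p' q'] /=; lra.
Qed.

Lemma orlicz_numerical_radius_le x y z phi : N y <= 1 -> orlicz_function phi ->
  phi (numerical_radius (x * y * star z)) <=
    N y / 2 * N (real_calculus phi (x * star x) + real_calculus phi (z * star z)).
Proof.
move=> y1 phiO; set w := x * y * star z; set Q := _ * N _.
have Ny := norm_ge0 y.
have Q0 : 0 <= Q by rewrite mulr_ge0 ?norm_ge0 // divr_ge0.
have main f : @state R A f -> phi (complex.Re `|f w|) <= Q.
  move=> [[_ fpos] f1].
  have xs : star (x * star x) = x * star x by rewrite starM starK.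
  have zs : star (z * star z) = z * star z by rewrite starM starK.
  have [X0 jX] := jensen phiO fpos f1 xs (@spectrum_mul_star_ge0 _ _ x).
  have [Z0 jZ] := jensen phiO fpos f1 zs (@spectrum_mul_star_ge0 _ _ z).
  have := functional_mul_star_mid fpos x y z.
  have := functional_le fpos (real_calculus phi (x * star x) + real_calculus phi (z * star z)).
  rewrite f1 mul1r -/w; set v := _ + _; set e := complex.Re `|f w| => hv.
  move: X0 Z0 jX jZ; set X := complex.Re _; set Z := complex.Re (f (z * _)).
  move=> X0 Z0 jX jZ he.
  have fv : phi X + phi Z <= N v.
    apply: le_trans hv; apply: le_trans (_ : complex.Re (f v : R[i]) <= _).
      by apply: le_trans (lerD jX jZ) _; rewrite /v functionalD raddfD.
    apply: le_trans (ler_norm _) _; rewrite -lecR -cnormE; exact: normc_ge_Re.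
  have e0 : 0 <= e by apply: cnorm_ge0.
  have m0 : 0 <= 2^-1 * X + (1 - 2^-1) * Z by lra.
  (* As [N y <= 1], the bound on [e] is a convex combination of the mean of [X] and [Z] with 0;
     convexity and [phi 0 = 0] then take the factor [N y] out of [phi]. *)
  have step1 : phi e <= phi (N y * (2^-1 * X + (1 - 2^-1) * Z) + (1 - N y) * 0).
    have nneg (t : R) : 0 <= t -> t \in `[0, +oo[ by rewrite in_itv /= andbT.
    apply: (orlicz_nondecreasing phiO); [exact: nneg|apply: nneg|].
      by rewrite mulr0 addr0 mulr_ge0.
    lra.
  apply: le_trans step1 _.
  have y01 : 0 <= N y <= 1 by rewrite Ny y1.
  apply: le_trans (orlicz_conv phiO y01 m0 (lexx 0)) _.
  rewrite (orlicz0 phiO) mulr0 addr0 /Q -mulrA ler_wpM2l //.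
  have h01 : 0 <= (2^-1 : R) <= 1 by lra.
  apply: le_trans (orlicz_conv phiO h01 X0 Z0) _; lra.
rewrite leNgt; apply/negP => lt.
set S := [set complex.Re `|g w| | g in @state R A].
have S0 : S !=set0.
  (* Without states the supremum would be the default value 0, and [phi 0 = 0 <= Q]. *)
  apply: contrapT => /set0P/negP/negPn/eqP S0; move: lt.
  by rewrite /numerical_radius -/S S0 sup0 (orlicz0 phiO) ltNge Q0.
have hS : has_sup S.
  split=> //; exists (N w) => _ [f [[_ fpos] f1] <-].
  by have := functional_le fpos w; rewrite f1 mul1r.
move: lt; rewrite /numerical_radius -/S => lt.
have v0 : 0 <= sup S.
  have [_ [f sf _]] := S0; apply: le_trans (cnorm_ge0 (f w)) _.
  by apply: ub_le_sup; [exact: hS.2|exists f].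
(* Continuity of [phi] at the supremum carries the bound over from states that nearly attain it. *)
have := orlicz_continuous phiO.
move=> /subspace_continuousP /(_ (sup S)); rewrite /= in_itv /= v0 => /(_ isT).
have d0 : 0 < phi (sup S) - Q by rewrite subr_gt0.
move=> /cvgrPdist_lt/(_ _ d0)/nbhs_normP [d dd hd].
have [_ [f sf <-] hf] := sup_adherent (dd : 0 < d) hS.
have fle : complex.Re `|f w| <= sup S by apply: ub_le_sup; [exact: hS.2|exists f].
have e0 := cnorm_ge0 (f w); have := main _ sf.
move: (complex.Re `|f w|) hf fle e0 => e hf fle e0 ephi.
have : `|phi (sup S) - phi e| < phi (sup S) - Q.
  apply: hd; last by rewrite /= in_itv /= e0.
  by rewrite /= ger0_norm ?subr_ge0 //; lra.
by have := ler_norm (phi (sup S) - phi e); lra.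
Qed.

End Jensen.

(** * Weighted functionals and part (a) *)

Section Compression.
Context {R : realType} {A : cstarAlgType R}.
Variables (f : {linear A -> R[i]^o}) (z : A) (k : R[i]).

(** Taking [k] to be the inverse of [f (star z * a * z)] makes this an element of [state_at a], to
    which the bound defining [seminorm_at a] applies. *)
Definition compression (w : A) : R[i]^o := k * f (star z * w * z).

Lemma compression_is_linear : linear compression.
Proof.
move=> c x y; rewrite /compression mulrDr mulrDl -scalerAr -scalerAl linearP.
by rewrite mulrDr; congr (_ + _); rewrite mulrCA.
Qed.

HB.instance Definition _ :=
  GRing.isLinear.Build R[i] A R[i]^o *:%R compression compression_is_linear.

Lemma compression_positive : positive_functional f -> 0 <= k ->
  positive_functional compression.
Proof.
move=> [[M fM] fpos] k0; split.
  exists (complex.Re `|k| * (`|M| * cstar_norm z ^+ 2)) => x.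
  rewrite [X in complex.Re `|X|](_ : _ = k * f (star z * x * z)) // cnormM -!mulrA ler_wpM2l ?cnorm_ge0 //.
  apply: le_trans (fM _) _; apply: le_trans (_ : `|M| * cstar_norm (star z * (x * z)) <= _).
    by rewrite ler_wpM2r ?norm_ge0 ?ler_norm // mulrA.
  rewrite ler_wpM2l //; apply: le_trans (cstar_normM _ _) _.
  by rewrite norm_star ler_wpM2l ?norm_ge0 // [leRHS]mulrC cstar_normM.
move=> x /=; rewrite /compression mulr_ge0 //.
have -> : star z * (star x * x) * z = star (x * z) * (x * z).
  by rewrite starM !mulrA.
exact: fpos.
Qed.

End Compression.

Section WeightedRadius.
Context {R : realType} {A : cstarAlgType R} (a : A).
Hypothesis a_pos : positive a.
Implicit Types (x y z u v : A).

Local Notation N := (@cstar_norm R A).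

Lemma weighted_cauchy_schwarz (f : {linear A -> R[i]^o}) u v :
  positive_functional f ->
  [/\ f (star u * a * u) = (complex.Re (f (star u * a * u) : R[i]))%:C :> R[i],
      0 <= complex.Re (f (star u * a * u) : R[i]) &
  complex.Re `|f (star u * a * v)| ^+ 2 <=
    complex.Re (f (star u * a * u) : R[i]) * complex.Re (f (star v * a * v) : R[i])].
Proof.
move=> [_ fpos]; have [as_ ap] := a_pos.
have [b [bs b2 _]] := sqrt_of_spectrum_ge0 as_ ap.
have E s t : star s * a * t = star (b * s) * (b * t).
  by rewrite starM bs -b2 expr2 !mulrA.
by rewrite !E; split; [apply: functional_mul_starE|apply: functional_mul_star_ge0|
  apply: cauchy_schwarz].
Qed.

(** When [f (star z * a * z)] is nonzero, the normalized compression of [f] by [z] is tested against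
    the supremum defining the seminorm. Otherwise an adjoint [ys] rewrites the left-hand side as
    [f (star z * a * (ys * y * z))], which vanishes by Cauchy-Schwarz. *)
Lemma weighted_seminorm_bound (f : {linear A -> R[i]^o}) y z (s : R) :
  positive_functional f -> adjointable_at a y -> 0 <= s ->
  seminorm_at a y = s%:E ->
  complex.Re (f (star (y * z) * a * (y * z)) : R[i]) <=
    s ^+ 2 * complex.Re (f (star z * a * z) : R[i]).
Proof.
move=> fpos [ys yys] s0 sE.
have [zE z0 _] := weighted_cauchy_schwarz z z fpos.
have [yzE yz0 _] := weighted_cauchy_schwarz (y * z) z fpos.
have [z1|z1] := eqVneq (complex.Re (f (star z * a * z) : R[i])) 0.
  have [_ _] := weighted_cauchy_schwarz z (ys * y * z) fpos.
  rewrite z1 mul0r mulr0.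
  have -> : star z * a * (ys * y * z) = star (y * z) * a * (y * z).
    by rewrite starM !mulrA -(mulrA (star z) a ys) yys !mulrA.
  rewrite yzE cnormr real_normK ?num_real // => h.
  have : complex.Re (f (star (y * z) * a * (y * z)) : R[i]) ^+ 2 == 0.
    by rewrite eq_le h sqr_ge0.
  by rewrite sqrf_eq0 => /eqP ->.
have zp : 0 < complex.Re (f (star z * a * z) : R[i]) by rewrite lt_neqAle eq_sym z1.
set beta := complex.Re (f (star z * a * z) : R[i]) in zE z0 z1 zp *.
pose g : {linear A -> R[i]^o} := compression f z (beta^-1)%:C.
have ga : state_at a g.
  split; first by apply: compression_positive => //; rewrite ler0c invr_ge0.
  by rewrite /g /= /compression zE -rmorphM mulVf.
have : ((Num.sqrt (complex.Re (g (star y * a * y) : R[i])))%:E <= s%:E)%E.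
  by rewrite -sE; apply: ereal_sup_ubound; exists g.
rewrite lee_fin => h.
have gE : g (star y * a * y) = (beta^-1 * complex.Re (f (star (y * z) * a * (y * z)) : R[i]))%:C :> R[i].
  rewrite rmorphM /= -yzE /compression; congr (_ * f _).
  by rewrite starM !mulrA.
rewrite gE /= in h.
have p0 : 0 <= beta^-1 * complex.Re (f (star (y * z) * a * (y * z)) : R[i]).
  by rewrite mulr_ge0 // invr_ge0.
move: h; rewrite -(@ler_pXn2r _ 2) ?nnegrE ?sqrtr_ge0 // sqr_sqrtr //.
by rewrite mulrC ler_pdivrMr.
Qed.

Lemma weighted_numerical_radius_le x y z xs zs :
  adjointable_at a y -> is_adjoint_at a x xs -> is_adjoint_at a z zs ->
  (seminorm_at a y <= 1)%E ->
  (numerical_radius_at a (x * y * zs)%R <=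
     seminorm_at a y * (2^-1)%:E * seminorm_at a (x * xs + z * zs)%R)%E.
Proof.
move=> ay xxs zzs y1; have [as_ ap] := a_pos.
apply: ge_ereal_sup => _ [f [fpos f1] <-].
(* The functional [f] at hand bounds the seminorm of [y] below by a nonnegative real, which excludes
   the value -oo of an empty supremum. *)
have [s s0 sE] : exists2 s : R, 0 <= s & seminorm_at a y = s%:E.
  have : ((Num.sqrt (complex.Re (f (star y * a * y) : R[i])))%:E <= seminorm_at a y)%E.
    by apply: ereal_sup_ubound; exists f.
  move: y1; case: (seminorm_at a y) => [s|//|//] _; rewrite lee_fin => h.
  by exists s => //; apply: le_trans h; apply: sqrtr_ge0.
rewrite sE; set w := x * xs + z * zs.
have axs u us : is_adjoint_at a u us -> star us * a = a * u.
  by move=> h; rewrite -[LHS]starK starM starK as_ h starM starK as_.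
pose q := Num.sqrt (complex.Re (f (star w * a * w) : R[i])).
apply: le_trans (_ : (s%:E * (2^-1)%:E * q%:E <= _)%E); last first.
  rewrite -(EFinM s) lee_wpmul2l ?lee_fin ?mulr_ge0 //.
  by apply: ereal_sup_ubound; exists f.
rewrite -!EFinM lee_fin.
have [_ al0 cs] := weighted_cauchy_schwarz xs (y * zs) fpos.
have [_ be0 _] := weighted_cauchy_schwarz zs zs fpos.
have yb := weighted_seminorm_bound zs fpos ay s0 sE.
have -> : a * (x * y * zs) = star xs * a * (y * zs) by rewrite (axs _ _ xxs) !mulrA.
(* The sum is [f (a * w)], and Cauchy-Schwarz against 1 bounds it by [q] because [f a = 1]. *)
have aw : complex.Re (f (star xs * a * xs) : R[i]) + complex.Re (f (star zs * a * zs) : R[i])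
     <= q.
  have -> : complex.Re (f (star xs * a * xs) : R[i]) +
      complex.Re (f (star zs * a * zs) : R[i]) = complex.Re (f (star 1 * a * w) : R[i]).
    rewrite star1 mul1r /w mulrDr functionalD raddfD (axs _ _ xxs) (axs _ _ zzs).
    by rewrite !mulrA.
  have [_ q0] := weighted_cauchy_schwarz w 1 fpos.
  have [_ _] := weighted_cauchy_schwarz 1 w fpos.
  rewrite star1 mul1r mulr1 f1 mul1r.
  set e := f (a * w) => h _.
  apply: le_trans (_ : complex.Re `|e| <= _).
    apply: le_trans (ler_norm _) _; rewrite -lecR -cnormE; exact: normc_ge_Re.
  rewrite -(@ler_pXn2r _ 2) ?nnegrE ?sqrtr_ge0 ?cnorm_ge0 // sqr_sqrtr //.
move: cs yb al0 be0 aw.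
set e := complex.Re `|f _|; set al := complex.Re (f (star xs * a * xs) : R[i]).
set be := complex.Re (f (star zs * a * zs) : R[i]).
have : 0 <= e by apply: cnorm_ge0.
move: (complex.Re (f (star (y * zs) * a * (y * zs)) : R[i])) => ga.
clearbody e al be => e0 cs yb al0 be0 aw.
apply: le_trans (_ : s / 2 * (al + be) <= _).
  rewrite -(@ler_pXn2r _ 2) ?nnegrE ?mulr_ge0 ?addr_ge0 ?invr_ge0 //.
  apply: le_trans cs _; apply: le_trans (ler_wpM2l al0 yb) _.
  rewrite -subr_ge0.
  have -> : (s / 2 * (al + be)) ^+ 2 - al * (s ^+ 2 * be) = (s / 2 * (al - be)) ^+ 2 by field.
  exact: sqr_ge0.
by rewrite ler_wpM2l // divr_ge0.
Qed.

End WeightedRadius.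

Theorem theorem2p30 (R : realType) (A : cstarAlgType R) (a : A)
    (a_neq0 : a <> 0) (a_pos : positive a) :
  (forall x y z xs zs : A,
      adjointable_at a x -> adjointable_at a y -> adjointable_at a z ->
      is_adjoint_at a x xs -> is_adjoint_at a z zs ->
      (seminorm_at a y <= 1)%E ->
      (numerical_radius_at a (x * y * zs)%R <=
         seminorm_at a y * (2^-1)%:E * seminorm_at a (x * xs + z * zs)%R)%E)
  /\
  (forall (x y z : A) (phi : R -> R),
      cstar_norm y <= 1 -> orlicz_function phi ->
      phi (numerical_radius (x * y * star z)) <=
        cstar_norm y / 2 *
          cstar_norm (real_calculus phi (x * star x) +
                      real_calculus phi (z * star z))).
Proof.
split.
  by move=> x y z xs zs _ ay _ xxs zzs y1; apply: weighted_numerical_radius_le.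
by move=> x y z phi y1 phiO; apply: orlicz_numerical_radius_le.
Qed.
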